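(* Let $S$ be a non-empty set, $V$ a vector space, $E$ a vector lattice, $A$ a vector lattice algebra, and $A^1$ a unital vector lattice algebra. Then the following 15 free objects all exist: (a) over $S$: $F_{\mathrm{Set}}^{\mathrm{VS}}[S]$, $F_{\mathrm{Set}}^{\mathrm{VL}}[S]$, $F_{\mathrm{Set}}^{\mathrm{VLA}}[S]$, $F_{\mathrm{Set}}^{\mathrm{VLA}^1}[S]$, $F_{\mathrm{Set}}^{\mathrm{VLA}^{1+}}[S]$; (b) over $V$: $F_{\mathrm{VS}}^{\mathrm{VL}}[V]$, $F_{\mathrm{VS}}^{\mathrm{VLA}}[V]$, $F_{\mathrm{VS}}^{\mathrm{VLA}^1}[V]$, $F_{\mathrm{VS}}^{\mathrm{VLA}^{1+}}[V]$; (c) over $E$: $F_{\mathrm{VL}}^{\mathrm{VLA}}[E]$, $F_{\mathrm{VL}}^{\mathrm{VLA}^1}[E]$, $F_{\mathrm{VL}}^{\mathrm{VLA}^{1+}}[E]$; (d) over $A$: $F_{\mathrm{VLA}}^{\mathrm{VLA}^1}[A]$, $F_{\mathrm{VLA}}^{\mathrm{VLA}^{1+}}[A]$; (e) over $A^1$: $F_{\mathrm{VLA}^1}^{\mathrm{VLA}^{1+}}[A^1]$. Moreover, the following inclusions hold, in the sense that the canonical maps are injective: $$S\subset F_{\mathrm{Set}}^{\mathrm{VS}}[S]\subset F_{\mathrm{Set}}^{\mathrm{VL}}[S]\subset F_{\mathrm{Set}}^{\mathrm{VLA}}[S],\qquad F_{\mathrm{Set}}^{\mathrm{VLA}}[S]\subset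 F_{\mathrm{Set}}^{\mathrm{VLA}^1}[S],\qquad F_{\mathrm{Set}}^{\mathrm{VLA}}[S]\subset F_{\mathrm{Set}}^{\mathrm{VLA}^{1+}}[S];$$ $$V\subset F_{\mathrm{VS}}^{\mathrm{VL}}[V]\subset F_{\mathrm{VS}}^{\mathrm{VLA}}[V],\qquad F_{\mathrm{VS}}^{\mathrm{VLA}}[V]\subset F_{\mathrm{VS}}^{\mathrm{VLA}^1}[V],\qquad F_{\mathrm{VS}}^{\mathrm{VLA}}[V]\subset F_{\mathrm{VS}}^{\mathrm{VLA}^{1+}}[V];$$ $$E\subset F_{\mathrm{VL}}^{\mathrm{VLA}}[E],\qquad F_{\mathrm{VL}}^{\mathrm{VLA}}[E]\subset F_{\mathrm{VL}}^{\mathrm{VLA}^1}[E],\qquad F_{\mathrm{VL}}^{\mathrm{VLA}}[E]\subset F_{\mathrm{VL}}^{\mathrm{VLA}^{1+}}[E];$$ $$A\subset F_{\mathrm{VLA}}^{\mathrm{VLA}^1}[A],\qquad A\subset F_{\mathrm{VLA}}^{\mathrm{VLA}^{1+}}[A].$$ Finally, the canonical unital vector lattice algebra homomorphisms $$F_{\mathrm{Set}}^{\mathrm{VLA}^1}[S]\to F_{\mathrm{Set}}^{\mathrm{VLA}^{1+}}[S],\quad F_{\mathrm{VS}}^{\mathrm{VLA}^1}[V]\to F_{\mathrm{VS}}^{\mathrm{VLA}^{1+}}[V],\quad F_{\mathrm{VL}}^{\mathrm{VLA}^1}[E]\to F_{\mathrm{VL}}^{\mathrm{VLA}^{1+}}[E],$$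 $$F_{\mathrm{VLA}}^{\mathrm{VLA}^1}[A]\to F_{\mathrm{VLA}}^{\mathrm{VLA}^{1+}}[A],\quad A^1=F_{\mathrm{VLA}^1}^{\mathrm{VLA}^1}[A^1]\to F_{\mathrm{VLA}^1}^{\mathrm{VLA}^{1+}}[A^1]$$ are surjective, and each of them is the quotient map corresponding to dividing out the bi-ideal of its domain that is generated by $|1|-1$, where $1$ is the identity element of the domain.
   Context: All vector spaces are over the real numbers. An algebra is an associative real algebra, not necessarily unital or commutative. A vector lattice algebra is a vector lattice that is also an algebra such that the product of two positive elements is positive. The identity element of a unital vector lattice algebra need not be positive (and $1=0$ is not excluded). A vector lattice algebra homomorphism is a linear map between vector lattice algebras that is a lattice homomorphism and an algebra homomorphism (not required to be unital, even between unital algebras); it is called unital if it maps the identity element to the identity element. A bi-ideal in a vector lattice algebra is a linear subspace that is an order ideal as well as a two-sided algebra ideal; $|x|=x\vee(-x)$. Categories: $\mathrm{Set}$: sets with maps; $\mathrm{VS}$: vector spaces with linear maps; $\mathrm{VL}$: vector lattices with vector lattice homomorphisms; $\mathrm{VLA}$: vector lattice algebras with vector lattice algebra homomorphisms; $\mathrm{VLA}^1$: unital vector lattice algebras with unital vector lattice algebra homomorphisms; $\mathrm{VLA}^{1+}$: unital vector lattice algebras with a positive identity element, with unital vector lattice algebra homomorphisms. In the chain $\mathrm{Set}\supset\mathrm{VS}\supset\mathrm{VL}\supset\mathrm{VLA}\supset\mathrm{VLA}^1\supset\mathrm{VLA}^{1+}$, each category is regarded as a subcategory of those to the left of it (by forgetting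 structure). Free objects: let $\mathrm{Cat}_2$ be a subcategory of $\mathrm{Cat}_1$ and let $O_1$ be an object of $\mathrm{Cat}_1$. A free object over $O_1$ of $\mathrm{Cat}_2$ is a pair $(j,F_{\mathrm{Cat}_1}^{\mathrm{Cat}_2}[O_1])$, where $F_{\mathrm{Cat}_1}^{\mathrm{Cat}_2}[O_1]$ is an object of $\mathrm{Cat}_2$ and $j:O_1\to F_{\mathrm{Cat}_1}^{\mathrm{Cat}_2}[O_1]$ is a morphism of $\mathrm{Cat}_1$, such that for every object $O_2$ of $\mathrm{Cat}_2$ and every morphism $\varphi:O_1\to O_2$ of $\mathrm{Cat}_1$ there is a unique morphism $\overline{\varphi}:F_{\mathrm{Cat}_1}^{\mathrm{Cat}_2}[O_1]\to O_2$ of $\mathrm{Cat}_2$ with $\varphi=\overline{\varphi}\circ j$. Such a pair, if it exists, is unique up to a unique compatible isomorphism. Canonical maps: the canonical map from $O_1$ to a free object over $O_1$ is $j$. If $\mathrm{Cat}_1\supset\mathrm{Cat}_2\supset\mathrm{Cat}_3$ and both free objects over $O_1$ exist, with accompanying maps $j_2:O_1\to F_{\mathrm{Cat}_1}^{\mathrm{Cat}_2}[O_1]$ and $j_3:O_1\to F_{\mathrm{Cat}_1}^{\mathrm{Cat}_3}[O_1]$, the canonical map $F_{\mathrm{Cat}_1}^{\mathrm{Cat}_2}[O_1]\to F_{\mathrm{Cat}_1}^{\mathrm{Cat}_3}[O_1]$ is the unique morphism $\psi$ of $\mathrm{Cat}_2$ with $j_3=\psi\circ j_2$. *)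

(* Defs.v *)
From HB Require Import structures.
From mathcomp Require Import all_boot all_order all_algebra.
From mathcomp Require Import boolp classical_sets reals.

Set Implicit Arguments.
Unset Strict Implicit.
Unset Printing Implicit Defensive.

Import Order.TTheory GRing.Theory Num.Theory.

Local Open Scope ring_scope.
Local Open Scope quotient_scope.
Local Open Scope classical_set_scope.

(* The library's lattices cannot be joined with its modules, since numeric
   domains already are lattices and groups, so the lattice operations are
   specified here exactly as in the library, over the library's joint
   structure of partial order and abelian group. See vl_lattice below. *)
HB.mixin Record POrderedLmodule_isVectorLattice (R : realType) V
    of GRing.Lmodule R V & Num.POrderedZmodule V := {
  vl_leD2r : forall z x y : V, x <= y -> x + z <= y + z;
  vl_leZ2l : forall (a : R) (x y : V), 0 <= a -> x <= y -> a *: x <= a *: y;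
  vl_inf : V -> V -> V;
  vl_sup : V -> V -> V;
  vl_lexI : forall x y z : V, (x <= vl_inf y z) = (x <= y) && (x <= z);
  vl_leUx : forall x y z : V, (vl_sup x y <= z) = (x <= z) && (y <= z)
}.

#[short(type="vlType")]
HB.structure Definition VectorLattice (R : realType) :=
  {V of GRing.Lmodule R V & Num.POrderedZmodule V &
        POrderedLmodule_isVectorLattice R V}.

Definition vl_lattice (R : realType) (E : vlType R) :
    latticeType ring_display :=
  HB.pack_for (latticeType ring_display) (VectorLattice.sort E)
    (Order.POrder_MeetJoin_isLattice.Build ring_display
       (VectorLattice.sort E) (@vl_lexI R E) (@vl_leUx R E)).

(* The multiplication of an algebra is the one of the library's semigroups,
   written in group_scope: the library's ring structures all have an identity
   element. *)
HB.mixin Record VectorLattice_isVLA (R : realType) A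
    of VectorLattice R A & Semigroup A := {
  vla_mulDl : forall x y z : A, ((x + y)%R * z)%g = (x * z)%g + (y * z)%g;
  vla_mulDr : forall x y z : A, (x * (y + z)%R)%g = (x * y)%g + (x * z)%g;
  vla_mulZl : forall (a : R) (x y : A), ((a *: x)%R * y)%g = a *: (x * y)%g;
  vla_mulZr : forall (a : R) (x y : A), (x * (a *: y)%R)%g = a *: (x * y)%g;
  vla_mul_ge0 : forall x y : A, 0 <= x -> 0 <= y -> 0 <= (x * y)%g
}.

#[short(type="vlaType")]
HB.structure Definition VLA (R : realType) :=
  {A of VectorLattice R A & Semigroup A & VectorLattice_isVLA R A}.

#[short(type="uvlaType")]
HB.structure Definition UVLA (R : realType) := {A of VLA R A & Monoid A}.

HB.mixin Record UVLA_hasPositiveOne (R : realType) A of UVLA R A := {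
  uvla_one_ge0 : 0 <= (1%g : A)
}.

#[short(type="upvlaType")]
HB.structure Definition UPVLA (R : realType) :=
  {A of UVLA R A & UVLA_hasPositiveOne R A}.

Section Morphisms.
Variable R : realType.

Definition set_map (X Y : Type) (f : X -> Y) : Prop := True.

Definition vs_hom (V W : lmodType R) (f : V -> W) : Prop := linear f.

Definition vl_hom (E F : vlType R) (f : E -> F) : Prop :=
  [/\ linear f, {morph f : x y / vl_sup x y}
    & {morph f : x y / vl_inf x y}].

Definition vla_hom (A B : vlaType R) (f : A -> B) : Prop :=
  vl_hom f /\ {morph f : x y / (x * y)%g}.

Definition uvla_hom (A B : uvlaType R) (f : A -> B) : Prop :=
  vla_hom f /\ f 1%g = 1%g.

Definition upvla_hom (A B : upvlaType R) (f : A -> B) : Prop := uvla_hom f.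

End Morphisms.

(* C2 is the class of objects of the smaller category, with underlying sets
   given by carrier and morphisms by hom2; hom1 Y is the set of morphisms of
   the larger category from the object with underlying set O1 to Y, where Y is
   regarded as an object of the larger category. *)
Definition free_object (O1 C2 : Type) (carrier : C2 -> Type)
    (hom1 : forall Y : C2, (O1 -> carrier Y) -> Prop)
    (hom2 : forall X Y : C2, (carrier X -> carrier Y) -> Prop)
    (F : C2) (j : O1 -> carrier F) : Prop :=
  hom1 F j /\
  forall (O2 : C2) (phi : O1 -> carrier O2), hom1 O2 phi ->
    exists! phibar : carrier F -> carrier O2,
      hom2 F O2 phibar /\ phi = phibar \o j.

Section FreeObjects.
Variable R : realType.

Section OverSet.
Variable S : Type.

Definition free_Set_VS (F : lmodType R) (j : S -> F) :=
  free_object (fun Y : lmodType R => @set_map S Y) (@vs_hom R) j.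
Definition free_Set_VL (F : vlType R) (j : S -> F) :=
  free_object (fun Y : vlType R => @set_map S Y) (@vl_hom R) j.
Definition free_Set_VLA (F : vlaType R) (j : S -> F) :=
  free_object (fun Y : vlaType R => @set_map S Y) (@vla_hom R) j.
Definition free_Set_UVLA (F : uvlaType R) (j : S -> F) :=
  free_object (fun Y : uvlaType R => @set_map S Y) (@uvla_hom R) j.
Definition free_Set_UPVLA (F : upvlaType R) (j : S -> F) :=
  free_object (fun Y : upvlaType R => @set_map S Y) (@upvla_hom R) j.
End OverSet.

Section OverVS.
Variable V : lmodType R.

Definition free_VS_VL (F : vlType R) (j : V -> F) :=
  free_object (fun Y : vlType R => @vs_hom R V Y) (@vl_hom R) j.
Definition free_VS_VLA (F : vlaType R) (j : V -> F) :=
  free_object (fun Y : vlaType R => @vs_hom R V Y) (@vla_hom R) j.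
Definition free_VS_UVLA (F : uvlaType R) (j : V -> F) :=
  free_object (fun Y : uvlaType R => @vs_hom R V Y) (@uvla_hom R) j.
Definition free_VS_UPVLA (F : upvlaType R) (j : V -> F) :=
  free_object (fun Y : upvlaType R => @vs_hom R V Y) (@upvla_hom R) j.
End OverVS.

Section OverVL.
Variable E : vlType R.

Definition free_VL_VLA (F : vlaType R) (j : E -> F) :=
  free_object (fun Y : vlaType R => @vl_hom R E Y) (@vla_hom R) j.
Definition free_VL_UVLA (F : uvlaType R) (j : E -> F) :=
  free_object (fun Y : uvlaType R => @vl_hom R E Y) (@uvla_hom R) j.
Definition free_VL_UPVLA (F : upvlaType R) (j : E -> F) :=
  free_object (fun Y : upvlaType R => @vl_hom R E Y) (@upvla_hom R) j.
End OverVL.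

Section OverVLA.
Variable A : vlaType R.

Definition free_VLA_UVLA (F : uvlaType R) (j : A -> F) :=
  free_object (fun Y : uvlaType R => @vla_hom R A Y) (@uvla_hom R) j.
Definition free_VLA_UPVLA (F : upvlaType R) (j : A -> F) :=
  free_object (fun Y : upvlaType R => @vla_hom R A Y) (@upvla_hom R) j.
End OverVLA.

Definition free_UVLA_UPVLA (A1 : uvlaType R) (F : upvlaType R) (j : A1 -> F) :=
  free_object (fun Y : upvlaType R => @uvla_hom R A1 Y) (@upvla_hom R) j.

End FreeObjects.

Definition canonical_map (O1 F2 F3 : Type) (hom2 : (F2 -> F3) -> Prop)
    (j2 : O1 -> F2) (j3 : O1 -> F3) (psi : F2 -> F3) : Prop :=
  unique (fun psi' => hom2 psi' /\ j3 = psi' \o j2) psi.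

Definition canonical_injective (O1 F2 F3 : Type) (hom2 : (F2 -> F3) -> Prop)
    (j2 : O1 -> F2) (j3 : O1 -> F3) : Prop :=
  exists psi : F2 -> F3, canonical_map hom2 j2 j3 psi /\ injective psi.

Section VectorLatticeTheory.
Variables (R : realType) (E : vlType R).
Implicit Types x y z d : E.

Definition vl_abs x : E := vl_sup x (- x).

Lemma vl_supC : commutative (@vl_sup R E).
Proof. exact: (@joinC _ (vl_lattice E)). Qed.

Lemma vl_infC : commutative (@vl_inf R E).
Proof. exact: (@meetC _ (vl_lattice E)). Qed.

Lemma vl_supA : associative (@vl_sup R E).
Proof. exact: (@joinA _ (vl_lattice E)). Qed.

Lemma vl_infA : associative (@vl_inf R E).
Proof. exact: (@meetA _ (vl_lattice E)). Qed.

Lemma vl_supKI y x : vl_inf x (vl_sup x y) = x.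
Proof. exact: (@joinKI _ (vl_lattice E)). Qed.

Lemma vl_infKU y x : vl_sup x (vl_inf x y) = x.
Proof. exact: (@meetKU _ (vl_lattice E)). Qed.

Lemma vl_infxx x : vl_inf x x = x.
Proof. exact: (@meetxx _ (vl_lattice E)). Qed.

Lemma vl_leEinf x y : (x <= y) = (vl_inf x y == x).
Proof. exact: (@leEmeet _ (vl_lattice E)). Qed.

Lemma vl_leUl x y : x <= vl_sup x y.
Proof. exact: (@leUl _ (vl_lattice E)). Qed.

Lemma vl_leUr x y : y <= vl_sup x y.
Proof. exact: (@leUr _ (vl_lattice E)). Qed.

Lemma vl_leIl x y : vl_inf x y <= x.
Proof. exact: (@leIl _ (vl_lattice E)). Qed.

Lemma vl_leIr x y : vl_inf x y <= y.
Proof. exact: (@leIr _ (vl_lattice E)). Qed.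

Lemma vl_leD2rE z x y : (x + z <= y + z) = (x <= y).
Proof.
apply/idP/idP => [/(vl_leD2r (- z))|/vl_leD2r]; last exact.
by rewrite !addrK.
Qed.

Lemma vl_subr_le x y z : (x - y <= z) = (x <= z + y).
Proof. by rewrite -(vl_leD2rE y _ z) subrK. Qed.

Lemma vl_le_subr x y z : (x <= y - z) = (x + z <= y).
Proof. by rewrite -(vl_leD2rE z x) subrK. Qed.

Lemma vl_subr_ge0 x y : (0 <= y - x) = (x <= y).
Proof. by rewrite vl_le_subr add0r. Qed.

Lemma vl_leN2 x y : (- x <= - y) = (y <= x).
Proof. by rewrite -(vl_subr_ge0 (- x)) opprK addrC vl_subr_ge0. Qed.

Lemma vl_joinDr x y z : vl_sup (x + z) (y + z) = vl_sup x y + z.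
Proof.
apply/le_anti; rewrite vl_leUx !vl_leD2rE vl_leUl vl_leUr /=.
by rewrite -vl_le_subr vl_leUx !vl_le_subr vl_leUl vl_leUr.
Qed.

Lemma vl_meetDr x y z : vl_inf (x + z) (y + z) = vl_inf x y + z.
Proof.
apply/le_anti; rewrite [in X in _ && X]vl_lexI !vl_leD2rE vl_leIl vl_leIr andbT.
by rewrite -vl_subr_le vl_lexI !vl_subr_le vl_leIl vl_leIr.
Qed.

Lemma vl_leZ_pos (a : R) x y : 0 < a -> (a *: x <= a *: y) = (x <= y).
Proof.
move=> a0; apply/idP/idP; last by apply: vl_leZ2l; exact: ltW.
move=> /(@vl_leZ2l R E a^-1); rewrite invr_ge0 => /(_ (ltW a0)).
by rewrite !scalerA mulVf ?gt_eqF// !scale1r.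
Qed.

Lemma vl_meetZ (a : R) x y : 0 <= a ->
  vl_inf (a *: x) (a *: y) = a *: vl_inf x y.
Proof.
rewrite le_eqVlt => /predU1P[<-|a0]; first by rewrite !scale0r vl_infxx.
have aK z : z = a *: (a^-1 *: z) by rewrite scalerA mulfV ?gt_eqF// scale1r.
apply/le_anti; rewrite [in X in _ && X]vl_lexI !vl_leZ_pos// vl_leIl vl_leIr andbT.
have H (w u : E) : (a^-1 *: w <= u) = (w <= a *: u) by rewrite -(vl_leZ_pos _ u a0) -aK.
by rewrite -H vl_lexI !H vl_leIl vl_leIr.
Qed.

Lemma vl_abs_le x y : (vl_abs x <= y) = (x <= y) && (- x <= y).
Proof. exact: vl_leUx. Qed.

Lemma vl_le_abs x : x <= vl_abs x. Proof. exact: vl_leUl. Qed.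

Lemma vl_absN x : vl_abs (- x) = vl_abs x.
Proof. by rewrite /vl_abs opprK vl_supC. Qed.

Lemma vl_abs_ge0 x : 0 <= vl_abs x.
Proof.
suff: (2^-1 : R) *: (0 + 0) <= (2^-1 : R) *: (vl_abs x + vl_abs x).
  by rewrite addr0 scaler0 -mulr2n -scaler_nat scalerA mulVf ?scale1r ?pnatr_eq0.
apply: vl_leZ2l; first by rewrite invr_ge0 ler0n.
rewrite addr0 -(subrr x); apply: (@le_trans _ _ (vl_abs x - x)).
  by rewrite vl_leD2rE vl_le_abs.
by rewrite ![vl_abs x + _]addrC vl_leD2rE vl_leUr.
Qed.

Lemma vl_abs_abs x : vl_abs (vl_abs x) = vl_abs x.
Proof.
apply/le_anti; rewrite vl_leUl andbT vl_leUx lexx /=; apply: (@le_trans _ _ 0); last exact: vl_abs_ge0.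
by rewrite -oppr0 vl_leN2 vl_abs_ge0.
Qed.

Lemma vl_le_add_abs x y : x <= y + vl_abs (x - y).
Proof. by rewrite addrC -vl_subr_le vl_le_abs. Qed.

Lemma vl_abs_meet x x' y :
  vl_abs (vl_inf x y - vl_inf x' y) <= vl_abs (x - x').
Proof.
have H u v : vl_inf u y <= vl_abs (u - v) + vl_inf v y.
  rewrite addrC -vl_meetDr vl_lexI (le_trans (vl_leIl _ _) (vl_le_add_abs _ _)) /=.
  by rewrite (le_trans (vl_leIr _ _))// addrC -vl_subr_le subrr vl_abs_ge0.
by rewrite vl_abs_le opprB !vl_subr_le H -vl_absN opprB H.
Qed.

Lemma vl_abs_join x x' y :
  vl_abs (vl_sup x y - vl_sup x' y) <= vl_abs (x - x').
Proof.
have H u v : vl_sup u y <= vl_abs (u - v) + vl_sup v y.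
  rewrite addrC -vl_joinDr vl_leUx (le_trans (vl_le_add_abs u v) (vl_leUl _ _)) /=.
  by rewrite (le_trans _ (vl_leUr _ _))// addrC -vl_subr_le subrr vl_abs_ge0.
by rewrite vl_abs_le opprB !vl_subr_le H -vl_absN opprB H.
Qed.

End VectorLatticeTheory.

Section BiIdeals.
Variables (R : realType) (A : vlaType R).

Record bi_ideal (I : set A) : Prop := {
  bi_ideal0 : I 0;
  bi_idealD : forall x y, I x -> I y -> I (x + y);
  bi_idealZ : forall (a : R) x, I x -> I (a *: x);
  bi_ideal_solid : forall x y, vl_abs x <= vl_abs y -> I y -> I x;
  bi_idealMl : forall x y, I y -> I (x * y)%g;
  bi_idealMr : forall x y, I x -> I (x * y)%g
}.

Record biIdeal := BiIdeal {
  biIdeal_set : set A;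
  biIdealP : bi_ideal biIdeal_set
}.

Lemma smallest_bi_ideal (G : set A) : bi_ideal (smallest bi_ideal G).
Proof.
split.
- by move=> I [[]].
- by move=> x y Ix Iy I HI; have [[_ h _ _ _ _] _] := HI; apply: h; [exact: Ix|exact: Iy].
- by move=> a x Ix I HI; have [[_ _ h _ _ _] _] := HI; apply: h; exact: Ix.
- by move=> x y xy Iy I HI; have [[_ _ _ h _ _] _] := HI; apply: h xy _; exact: Iy.
- by move=> x y Iy I HI; have [[_ _ _ _ h _] _] := HI; apply: h; exact: Iy.
- by move=> x y Ix I HI; have [[_ _ _ _ _ h] _] := HI; apply: h; exact: Ix.
Qed.

Definition bi_ideal_gen (x : A) : biIdeal :=
  BiIdeal (smallest_bi_ideal [set x]).

Definition biIdeal_pred (I : biIdeal) : A -> bool := fun x => `[< biIdeal_set I x >].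

Lemma biIdeal_predP (I : biIdeal) x : reflect (biIdeal_set I x) (x \in biIdeal_pred I).
Proof. exact: asboolP. Qed.

Lemma biIdeal_pred_zmod (I : biIdeal) : zmod_closed (biIdeal_pred I).
Proof.
split=> [|x y /biIdeal_predP Ix /biIdeal_predP Iy]; apply/biIdeal_predP.
  exact: bi_ideal0 (biIdealP I).
have [_ hD hZ _ _ _] := biIdealP I.
by apply: hD => //; rewrite -scaleN1r; exact: hZ.
Qed.

Definition biIdeal_zmod (I : biIdeal) : zmodClosed A :=
  HB.pack_for (zmodClosed A) (biIdeal_pred I)
    (GRing.isZmodClosed.Build A (biIdeal_pred I) (biIdeal_pred_zmod I)).

(* The quotient A / I; its additive group comes from the library's quotients of
   abelian groups, and the other operations are those induced on classes. *)
Definition vla_quot (I : biIdeal) : Type := Quotient.quot (biIdeal_zmod I).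

HB.instance Definition _ (I : biIdeal) :=
  ZmodQuotient.on (vla_quot I).

End BiIdeals.

Section VLAQuotient.
Variables (R : realType) (A : vlaType R) (I : biIdeal A).
Local Notation Q := (vla_quot I).
Implicit Types x y z : A.
Implicit Types X Y Z : Q.

Definition vla_pi : A -> Q := \pi_Q.

Lemma vla_piP X : exists x, X = vla_pi x.
Proof. by exists (repr X); rewrite /vla_pi reprK. Qed.

Lemma vla_pi_eq x y : vla_pi x = vla_pi y <-> biIdeal_set I (x - y).
Proof.
split=> [/eqP|Ixy]; first by rewrite -Quotient.idealrBE => /biIdeal_predP.
by apply/eqP; rewrite -Quotient.idealrBE; apply/biIdeal_predP.
Qed.

Lemma vla_piB x y : vla_pi (x - y) = vla_pi x - vla_pi y.
Proof. by rewrite /vla_pi !piE. Qed.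

Lemma vla_piD x y : vla_pi (x + y) = vla_pi x + vla_pi y.
Proof. by rewrite /vla_pi !piE. Qed.

Lemma vla_pi0 : vla_pi 0 = 0.
Proof. by rewrite /vla_pi !piE. Qed.

Definition vla_quot_scale (a : R) X : Q := vla_pi (a *: repr X).
Definition vla_quot_sup X Y : Q := vla_pi (vl_sup (repr X) (repr Y)).
Definition vla_quot_inf X Y : Q := vla_pi (vl_inf (repr X) (repr Y)).
Definition vla_quot_mul X Y : Q := vla_pi (repr X * repr Y)%g.

Lemma vla_pi_repr x : biIdeal_set I (repr (vla_pi x) - x).
Proof. by apply/vla_pi_eq; rewrite /vla_pi reprK. Qed.

Let vla_piZ a x : vla_pi (a *: x) = vla_quot_scale a (vla_pi x).
Proof.
apply/esym/vla_pi_eq; rewrite -scalerBr.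
by have [_ _ hZ _ _ _] := biIdealP I; apply: hZ; exact: vla_pi_repr.
Qed.

Let vla_pi_sup x y :
  vla_pi (vl_sup x y) = vla_quot_sup (vla_pi x) (vla_pi y).
Proof.
suff H u v w : biIdeal_set I (u - v) -> vla_pi (vl_sup u w) = vla_pi (vl_sup v w).
  by apply/esym; rewrite /vla_quot_sup (H _ _ _ (vla_pi_repr x)) vl_supC
    (H _ _ _ (vla_pi_repr y)) vl_supC.
move=> Iuv; apply/vla_pi_eq.
by have [_ _ _ hs _ _] := biIdealP I; apply: hs (vl_abs_join _ _ _) Iuv.
Qed.

Let vla_pi_inf x y :
  vla_pi (vl_inf x y) = vla_quot_inf (vla_pi x) (vla_pi y).
Proof.
suff H u v w : biIdeal_set I (u - v) -> vla_pi (vl_inf u w) = vla_pi (vl_inf v w).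
  by apply/esym; rewrite /vla_quot_inf (H _ _ _ (vla_pi_repr x)) vl_infC
    (H _ _ _ (vla_pi_repr y)) vl_infC.
move=> Iuv; apply/vla_pi_eq.
by have [_ _ _ hs _ _] := biIdealP I; apply: hs (vl_abs_meet _ _ _) Iuv.
Qed.

Let vla_pi_mul x y :
  vla_pi (x * y)%g = vla_quot_mul (vla_pi x) (vla_pi y).
Proof.
have mulBr u v w : (u * (v - w)%R)%g = (u * v)%g - (u * w)%g.
  by rewrite vla_mulDr -scaleN1r vla_mulZr scaleN1r.
have mulBl u v w : ((v - w)%R * u)%g = (v * u)%g - (w * u)%g.
  by rewrite vla_mulDl -scaleN1r vla_mulZl scaleN1r.
apply/esym/vla_pi_eq; rewrite -(subrKA (x * repr (vla_pi y))%g) -mulBl -mulBr.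
have [_ hD _ _ hMl hMr] := biIdealP I.
by apply: hD; [apply: hMr|apply: hMl]; exact: vla_pi_repr.
Qed.

Definition vla_quot_le X Y : bool := vla_quot_inf X Y == X.

Let infC : commutative vla_quot_inf.
Proof. by move=> X Y; rewrite /vla_quot_inf vl_infC. Qed.

Let supC : commutative vla_quot_sup.
Proof. by move=> X Y; rewrite /vla_quot_sup vl_supC. Qed.

Let infA : associative vla_quot_inf.
Proof.
move=> X Y Z; have [[x ->] [y ->] [z ->]] := And3 (vla_piP X) (vla_piP Y) (vla_piP Z).
by rewrite -!vla_pi_inf vl_infA.
Qed.

Let supA : associative vla_quot_sup.
Proof.
move=> X Y Z; have [[x ->] [y ->] [z ->]] := And3 (vla_piP X) (vla_piP Y) (vla_piP Z).
by rewrite -!vla_pi_sup vl_supA.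
Qed.

Let supKI Y X : vla_quot_inf X (vla_quot_sup X Y) = X.
Proof.
have [[x ->] [y ->]] := conj (vla_piP X) (vla_piP Y).
by rewrite -vla_pi_sup -vla_pi_inf vl_supKI.
Qed.

Let infKU Y X : vla_quot_sup X (vla_quot_inf X Y) = X.
Proof.
have [[x ->] [y ->]] := conj (vla_piP X) (vla_piP Y).
by rewrite -vla_pi_inf -vla_pi_sup vl_infKU.
Qed.

Let le_refl : reflexive vla_quot_le.
Proof.
by move=> X; have [x ->] := vla_piP X; rewrite /vla_quot_le -vla_pi_inf vl_infxx.
Qed.

Let le_anti : antisymmetric vla_quot_le.
Proof. by move=> X Y /andP[/eqP XY /eqP]; rewrite infC XY. Qed.

Let le_trans : transitive vla_quot_le.
Proof.
move=> Y X Z /eqP XY /eqP YZ; apply/eqP.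
by rewrite -XY -infA YZ.
Qed.

HB.instance Definition _ :=
  Order.Le_isPOrder.Build ring_display Q le_refl le_anti le_trans.

Let scaleA a b X :
  vla_quot_scale a (vla_quot_scale b X) = vla_quot_scale (a * b) X.
Proof. by have [x ->] := vla_piP X; rewrite -!vla_piZ scalerA. Qed.

Let scale1 : left_id 1 vla_quot_scale.
Proof. by move=> X; have [x ->] := vla_piP X; rewrite -vla_piZ scale1r. Qed.

Let scaleDr : right_distributive vla_quot_scale +%R.
Proof.
move=> a X Y; have [[x ->] [y ->]] := conj (vla_piP X) (vla_piP Y).
by rewrite -vla_piD -!vla_piZ -vla_piD scalerDr.
Qed.

Let scaleDl X : {morph vla_quot_scale^~ X : a b / a + b}.
Proof.
by move=> a b /=; have [x ->] := vla_piP X; rewrite -!vla_piZ -vla_piD scalerDl.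
Qed.

HB.instance Definition _ :=
  GRing.Zmodule_isLmodule.Build R Q scaleA scale1 scaleDr scaleDl.

Let L : latticeType ring_display :=
  HB.pack_for (latticeType ring_display) Q
   (Order.POrder_isLattice.Build ring_display Q
     infC supC infA supA supKI infKU (fun _ _ => erefl)).

Let leI X Y Z : (X <= vla_quot_inf Y Z) = (X <= Y) && (X <= Z).
Proof. exact: (@lexI _ L). Qed.

Let leU X Y Z : (vla_quot_sup X Y <= Z) = (X <= Z) && (Y <= Z).
Proof. exact: (@leUx _ L). Qed.

Let le_piP x y : (vla_pi x <= vla_pi y) <-> vla_pi (vl_inf x y) = vla_pi x.
Proof. by rewrite vla_pi_inf; split=> /eqP. Qed.

Let leD2r Z X Y : X <= Y -> X + Z <= Y + Z.
Proof.
have [[x ->] [y ->] [z ->]] := And3 (vla_piP X) (vla_piP Y) (vla_piP Z).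
by move=> /le_piP xy; rewrite -!vla_piD; apply/le_piP; rewrite vl_meetDr !vla_piD xy.
Qed.

Let leZ2l (a : R) X Y : 0 <= a -> X <= Y -> a *: X <= a *: Y.
Proof.
have [[x ->] [y ->]] := conj (vla_piP X) (vla_piP Y).
move=> a0 /le_piP xy; rewrite -[a *: vla_pi x]vla_piZ -[a *: vla_pi y]vla_piZ.
by apply/le_piP; rewrite vl_meetZ// !vla_piZ xy.
Qed.

HB.instance Definition _ :=
  POrderedLmodule_isVectorLattice.Build R Q leD2r leZ2l leI leU.

Let mulA : associative vla_quot_mul.
Proof.
move=> X Y Z; have [[x ->] [y ->] [z ->]] := And3 (vla_piP X) (vla_piP Y) (vla_piP Z).
by rewrite -!vla_pi_mul mulgA.
Qed.

HB.instance Definition _ := isSemigroup.Build Q mulA.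

Lemma vla_piM x y : vla_pi (x * y)%g = (vla_pi x * vla_pi y)%g.
Proof. exact: vla_pi_mul. Qed.

Lemma vla_piZr (a : R) x : vla_pi (a *: x) = a *: vla_pi x.
Proof. exact: vla_piZ. Qed.

Let mulDl X Y Z : ((X + Y)%R * Z)%g = (X * Z)%g + (Y * Z)%g.
Proof.
have [[x ->] [y ->] [z ->]] := And3 (vla_piP X) (vla_piP Y) (vla_piP Z).
by rewrite -vla_piD -!vla_piM vla_mulDl vla_piD.
Qed.

Let mulDr X Y Z : (X * (Y + Z)%R)%g = (X * Y)%g + (X * Z)%g.
Proof.
have [[x ->] [y ->] [z ->]] := And3 (vla_piP X) (vla_piP Y) (vla_piP Z).
by rewrite -vla_piD -!vla_piM vla_mulDr vla_piD.
Qed.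

Let mulZl (a : R) X Y : ((a *: X)%R * Y)%g = a *: (X * Y)%g.
Proof.
have [[x ->] [y ->]] := conj (vla_piP X) (vla_piP Y).
by rewrite -vla_piZr -!vla_piM vla_mulZl vla_piZr.
Qed.

Let mulZr (a : R) X Y : (X * (a *: Y)%R)%g = a *: (X * Y)%g.
Proof.
have [[x ->] [y ->]] := conj (vla_piP X) (vla_piP Y).
by rewrite -vla_piZr -!vla_piM vla_mulZr vla_piZr.
Qed.

Let ge0_lift X : 0 <= X -> exists2 x : A, 0 <= x & X = vla_pi x.
Proof.
have [x ->] := vla_piP X; rewrite -vla_pi0 => /le_piP x0.
exists (vl_sup x 0); first exact: vl_leUr.
rewrite -[in LHS](vl_infKU 0 x) !vla_pi_sup; congr vla_quot_sup.
by rewrite vl_infC.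
Qed.

Let mul_ge0 X Y : 0 <= X -> 0 <= Y -> 0 <= (X * Y)%g.
Proof.
move=> /ge0_lift[x x0 ->] /ge0_lift[y y0 ->].
rewrite -vla_piM -vla_pi0; apply/le_piP.
by have := vla_mul_ge0 x y x0 y0; rewrite vl_leEinf => /eqP ->.
Qed.

HB.instance Definition _ :=
  VectorLattice_isVLA.Build R Q mulDl mulDr mulZl mulZr mul_ge0.

Lemma vla_pi_hom : vla_hom vla_pi.
Proof.
split; last exact: vla_piM.
split; [|exact: vla_pi_sup|exact: vla_pi_inf].
by move=> a x y; rewrite vla_piD vla_piZr.
Qed.

End VLAQuotient.

Section UVLAQuotient.
Variables (R : realType) (A : uvlaType R) (I : biIdeal A).
Local Notation Q := (vla_quot I).

Let mul1q : left_id (vla_pi I 1%g) (@monoid.mul Q).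
Proof. by move=> X; have [x ->] := vla_piP X; rewrite -vla_piM mul1g. Qed.

Let mulq1 : right_id (vla_pi I 1%g) (@monoid.mul Q).
Proof. by move=> X; have [x ->] := vla_piP X; rewrite -vla_piM mulg1. Qed.

HB.instance Definition _ := Semigroup_isMonoid.Build Q mul1q mulq1.

Lemma uvla_pi_hom : uvla_hom (vla_pi I : A -> Q).
Proof. by split; first exact: vla_pi_hom. Qed.

End UVLAQuotient.

(* q is, up to an isomorphism of its codomain, the quotient map A -> A / I. *)
Definition is_quotient_map (R : realType) (A B : uvlaType R) (I : biIdeal A)
    (q : A -> B) : Prop :=
  exists h : vla_quot I -> B,
    [/\ uvla_hom h, bijective h & q = h \o vla_pi I].

Definition surjective (X Y : Type) (f : X -> Y) : Prop :=
  forall y, exists x, f x = y.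

Definition abs_one_ideal (R : realType) (A : uvlaType R) : biIdeal A :=
  bi_ideal_gen (vl_abs (1%g : A) - 1%g).

Definition canonical_quotient (R : realType) (O1 : Type) (F2 F3 : uvlaType R)
    (j2 : O1 -> F2) (j3 : O1 -> F3) : Prop :=
  exists psi : F2 -> F3,
    [/\ canonical_map (@uvla_hom R F2 F3) j2 j3 psi, surjective psi
      & is_quotient_map (abs_one_ideal F2) psi].

(* Main.v *)
Require Import Defs.
From HB Require Import structures.
From mathcomp Require Import all_boot all_order all_algebra.
From mathcomp Require Import boolp classical_sets reals.

(** All the objects are given by operations and equations, so a free object
over [O] is a quotient of the set of formal expressions in the elements of [O].
The quotient used here identifies two expressions when they take equal values
in every object [Y] along every admissible map [O -> Y] (linear, lattice
homomorphism, ..., according to the structure of [O]).  Evaluation along all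
these maps then embeds the quotient in a product of objects of the category, so
that every axiom of the category, and the admissibility of [O -> F], can be
checked after evaluation; evaluation along one of them is the factorization
asked for, and it is unique because the expressions are generated by the
variables ([quot_ev_unique], [free_object_family]).  An operation that the
category lacks is interpreted by zero, which allows one type of expressions for
all five categories.

A canonical map out of a free object is injective as soon as points can be
separated by homomorphisms that factor through it ([free_canonical_injective]).
Three constructions provide them: a vector space has enough linear functionals,
and the real line is a vector lattice ([separating_functional]); a vector
lattice becomes a vector lattice algebra with the zero product ([zero_vla]); a
vector lattice algebra [A] embeds in [A * R], which has the coordinatewise
order and the positive identity element [(0, 1)] ([unitization]).

For the last part, let [F5] and [F6] be the free objects over the same [O]
without and with the positivity of the identity.  The identity of the quotient
[Q] of [F5] by the bi-ideal generated by [|1| - 1] is the class of [|1|], hence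
positive, and every unital homomorphism to an object in which the identity is
positive kills [|1| - 1].  So there are homomorphisms [F6 -> Q] and [Q -> F6],
and the two universal properties make them mutually inverse
([free_uvla_upvla_quotient]). The case of an algebra [A1] with identity is the
special case in which [F5] is [A1] itself. *)

Set Implicit Arguments.
Unset Strict Implicit.
Unset Printing Implicit Defensive.
Import Order.TTheory GRing.Theory Num.Theory.
Local Open Scope ring_scope.
Local Open Scope quotient_scope.
Local Open Scope classical_set_scope.

(** * Linear maps and homomorphisms *)

Section LinearMaps.
Variables (R : realType) (V W : lmodType R) (f : V -> W).
Hypothesis f_lin : linear f.

Lemma lin_map0 : f 0 = 0.
Proof. by have := f_lin (-1) 0 0; rewrite !scaleN1r !addNr. Qed.

Lemma lin_mapD : {morph f : x y / x + y}.
Proof. by move=> x y; have := f_lin 1 x y; rewrite !scale1r. Qed.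

Lemma lin_mapZ a : {morph f : x / a *: x}.
Proof. by move=> x; have := f_lin a x 0; rewrite lin_map0 !addr0. Qed.

Lemma lin_mapN : {morph f : x / - x}.
Proof. by move=> x; rewrite -scaleN1r lin_mapZ scaleN1r. Qed.

Lemma lin_mapB : {morph f : x y / x - y}.
Proof. by move=> x y; rewrite lin_mapD lin_mapN. Qed.
End LinearMaps.

Section Composition.
Variable R : realType.

Lemma vs_hom_comp (U V W : lmodType R) (f : U -> V) (g : V -> W) :
  linear f -> linear g -> linear (g \o f).
Proof. by move=> fl gl a x y /=; rewrite fl gl. Qed.

Lemma vl_hom_comp (X Y Z : vlType R) (f : X -> Y) (g : Y -> Z) :
  vl_hom f -> vl_hom g -> vl_hom (g \o f).
Proof.
move=> [fl fU fI] [gl gU gI]; split; first exact: vs_hom_comp.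
- by move=> x y /=; rewrite fU gU.
- by move=> x y /=; rewrite fI gI.
Qed.

Lemma vla_hom_comp (X Y Z : vlaType R) (f : X -> Y) (g : Y -> Z) :
  vla_hom f -> vla_hom g -> vla_hom (g \o f).
Proof.
move=> [f1 fM] [g1 gM]; split; first exact: vl_hom_comp.
by move=> x y /=; rewrite fM gM.
Qed.

Lemma uvla_hom_comp (X Y Z : uvlaType R) (f : X -> Y) (g : Y -> Z) :
  uvla_hom f -> uvla_hom g -> uvla_hom (g \o f).
Proof.
move=> [f1 fe] [g1 ge]; split; first exact: vla_hom_comp.
by rewrite /= fe ge.
Qed.

Lemma vl_homW (X Y : vlType R) (f : X -> Y) : vl_hom f -> linear f.
Proof. by case. Qed.

Lemma vla_homW (X Y : vlaType R) (f : X -> Y) : vla_hom f -> vl_hom f.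
Proof. by case. Qed.

Lemma uvla_homW (X Y : uvlaType R) (f : X -> Y) : uvla_hom f -> vla_hom f.
Proof. by case. Qed.
End Composition.

Section VLHom.
Variables (R : realType) (E F : vlType R) (f : E -> F).
Hypothesis f_hom : vl_hom f.

Lemma vl_hom_abs x : f (vl_abs x) = vl_abs (f x).
Proof. by have [fl fU _] := f_hom; rewrite /vl_abs fU (lin_mapN fl). Qed.

Lemma vl_hom_le x y : x <= y -> f x <= f y.
Proof.
have [_ _ fI] := f_hom.
by rewrite !vl_leEinf => /eqP xy; rewrite -fI xy.
Qed.
End VLHom.

(** * Terms and their quotients *)

Section Terms.
Variables (R : realType) (O : Type).

Inductive term :=
| Var of O
| Zero
| Add of term & term
| Opp of term
| Scale of R & term
| Sup of term & term
| Inf of term & term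
| Mul of term & term
| One.

HB.instance Definition _ := gen_eqMixin term.
HB.instance Definition _ := gen_choiceMixin term.

(** The operations besides the linear ones obey no law here: a category that
lacks one of them can then be handled by interpreting it as zero. *)
Record opLmod := OpLmod {
  op_car :> lmodType R;
  op_sup : op_car -> op_car -> op_car;
  op_inf : op_car -> op_car -> op_car;
  op_mul : op_car -> op_car -> op_car;
  op_one : op_car }.

Fixpoint term_ev (Y : opLmod) (phi : O -> Y) (t : term) : Y :=
  match t with
  | Var o => phi o
  | Zero => 0
  | Add s t => term_ev phi s + term_ev phi t
  | Opp s => - term_ev phi s
  | Scale a s => a *: term_ev phi s
  | Sup s t => op_sup (term_ev phi s) (term_ev phi t)
  | Inf s t => op_inf (term_ev phi s) (term_ev phi t)
  | Mul s t => op_mul (term_ev phi s) (term_ev phi t)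
  | One => op_one Y
  end.

Record op_hom (Y Z : opLmod) (f : Y -> Z) : Prop := {
  op_hom_linear : linear f;
  op_homU : {morph f : x y / op_sup x y};
  op_homI : {morph f : x y / op_inf x y};
  op_homM : {morph f : x y / op_mul x y};
  op_homE : f (op_one Y) = op_one Z }.

Section Quot.
Variables (I : Type) (Y : I -> opLmod) (phi : forall i, O -> Y i).

(** The family will consist of all objects of a category, so its index type
lives in a larger universe than the terms; as it occurs in a proposition only,
the quotient stays in the universe of the terms. *)
Definition term_eq (s t : term) : bool :=
  `[< forall i, term_ev (@phi i) s = term_ev (@phi i) t >].

Lemma term_eqP s t :
  reflect (forall i, term_ev (@phi i) s = term_ev (@phi i) t) (term_eq s t).
Proof. exact: asboolP. Qed.

Lemma term_eq_refl : reflexive term_eq. Proof. by move=> s; apply/term_eqP. Qed.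
Lemma term_eq_sym : symmetric term_eq.
Proof. by move=> s t; apply/term_eqP/term_eqP. Qed.
Lemma term_eq_trans : transitive term_eq.
Proof. by move=> t s u /term_eqP st /term_eqP tu; apply/term_eqP => i; rewrite st. Qed.

Canonical term_eq_equiv := EquivRel term_eq term_eq_refl term_eq_sym term_eq_trans.

Definition term_quot : Type := {eq_quot term_eq}.
HB.instance Definition _ := Choice.on term_quot.

Definition quot_class (t : term) : term_quot := \pi_{eq_quot term_eq} t.
Definition quot_repr (x : term_quot) : term := repr (x : {eq_quot term_eq}).

Lemma quot_reprK x : quot_class (quot_repr x) = x.
Proof. exact: reprK. Qed.

Definition quot_ev (i : I) (x : term_quot) : Y i := term_ev (@phi i) (quot_repr x).

Lemma quot_evE i t : quot_ev i (quot_class t) = term_ev (@phi i) t.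
Proof.
have: repr (\pi_{eq_quot term_eq} t) = t %[mod {eq_quot term_eq}] by rewrite reprK.
by move/eqmodP/term_eqP/(_ i).
Qed.

(** The evaluations are jointly injective, which reduces every identity in the
quotient to the same identity in each member of the family. *)
Lemma quot_ev_inj x y : (forall i, quot_ev i x = quot_ev i y) -> x = y.
Proof.
move=> H; rewrite -[x]quot_reprK -[y]quot_reprK.
by apply/eqmodP/term_eqP => i; apply: H.
Qed.

Definition quot0 := quot_class Zero.
Definition quotD x y := quot_class (Add (quot_repr x) (quot_repr y)).
Definition quotN x := quot_class (Opp (quot_repr x)).
Definition quotZ a x := quot_class (Scale a (quot_repr x)).
Definition quot_sup x y := quot_class (Sup (quot_repr x) (quot_repr y)).
Definition quot_inf x y := quot_class (Inf (quot_repr x) (quot_repr y)).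
Definition quot_mul x y := quot_class (Mul (quot_repr x) (quot_repr y)).
Definition quot_one := quot_class One.

Let ev0 i : quot_ev i quot0 = 0. Proof. exact: quot_evE. Qed.
Let evD i x y : quot_ev i (quotD x y) = quot_ev i x + quot_ev i y.
Proof. exact: quot_evE. Qed.
Let evN i x : quot_ev i (quotN x) = - quot_ev i x. Proof. exact: quot_evE. Qed.
Let evZ i a x : quot_ev i (quotZ a x) = a *: quot_ev i x. Proof. exact: quot_evE. Qed.
Let evU i x y : quot_ev i (quot_sup x y) = op_sup (quot_ev i x) (quot_ev i y).
Proof. exact: quot_evE. Qed.
Let evI i x y : quot_ev i (quot_inf x y) = op_inf (quot_ev i x) (quot_ev i y).
Proof. exact: quot_evE. Qed.
Let evM i x y : quot_ev i (quot_mul x y) = op_mul (quot_ev i x) (quot_ev i y).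
Proof. exact: quot_evE. Qed.

Let addA : associative quotD.
Proof. by move=> x y z; apply: quot_ev_inj => i; rewrite !evD addrA. Qed.
Let addC : commutative quotD.
Proof. by move=> x y; apply: quot_ev_inj => i; rewrite !evD addrC. Qed.
Let add0 : left_id quot0 quotD.
Proof. by move=> x; apply: quot_ev_inj => i; rewrite evD ev0 add0r. Qed.
Let addN : left_inverse quot0 quotN quotD.
Proof. by move=> x; apply: quot_ev_inj => i; rewrite evD evN ev0 addNr. Qed.

HB.instance Definition _ := GRing.isZmodule.Build term_quot addA addC add0 addN.

Let scaleA a b x : quotZ a (quotZ b x) = quotZ (a * b) x.
Proof. by apply: quot_ev_inj => i; rewrite !evZ scalerA. Qed.
Let scale1 : left_id 1 quotZ.
Proof. by move=> x; apply: quot_ev_inj => i; rewrite evZ scale1r. Qed.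
Let scaleDr : right_distributive quotZ +%R.
Proof. by move=> a x y; apply: quot_ev_inj => i; rewrite evZ !evD !evZ scalerDr. Qed.
Let scaleDl x : {morph quotZ^~ x : a b / a + b}.
Proof. by move=> a b; apply: quot_ev_inj => i; rewrite evD !evZ scalerDl. Qed.

HB.instance Definition _ :=
  GRing.Zmodule_isLmodule.Build R term_quot scaleA scale1 scaleDr scaleDl.

Definition quot_ops : opLmod := OpLmod quot_sup quot_inf quot_mul quot_one.

Lemma quot_ev_hom i : @op_hom quot_ops (Y i) (@quot_ev i).
Proof.
split=> [a x y|x y|x y|x y|]; last 4 first; try exact: quot_evE.
by rewrite [LHS](evD i (a *: x) y) [quot_ev i (a *: x)](evZ i a x).
Qed.

Definition quot_gen (o : O) : term_quot := quot_class (Var o).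

Lemma quot_ev_gen i : @quot_ev i \o quot_gen = @phi i.
Proof. by apply/funext => o; exact: quot_evE. Qed.

(** Terms are generated by the variables, so a homomorphism on classes of terms
is determined by its values on the generators. *)
Lemma quot_ev_unique i (f : term_quot -> Y i) :
  @op_hom quot_ops (Y i) f -> @phi i = f \o quot_gen -> @quot_ev i = f.
Proof.
move=> [fl fU fI fM f1] phiE; apply/funext => x; rewrite -[x]quot_reprK quot_evE.
have clsD s t : quot_class (Add s t) = quot_class s + quot_class t.
  by apply: quot_ev_inj => j; rewrite evD !quot_evE.
have clsN s : quot_class (Opp s) = - quot_class s.
  by apply: quot_ev_inj => j; rewrite evN !quot_evE.
have clsZ a s : quot_class (Scale a s) = a *: quot_class s.
  by apply: quot_ev_inj => j; rewrite evZ !quot_evE.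
have clsU s t : quot_class (Sup s t) = quot_sup (quot_class s) (quot_class t).
  by apply: quot_ev_inj => j; rewrite evU !quot_evE.
have clsI s t : quot_class (Inf s t) = quot_inf (quot_class s) (quot_class t).
  by apply: quot_ev_inj => j; rewrite evI !quot_evE.
have clsM s t : quot_class (Mul s t) = quot_mul (quot_class s) (quot_class t).
  by apply: quot_ev_inj => j; rewrite evM !quot_evE.
elim: (quot_repr x) => /= [o||s -> t ->|s ->|a s ->|s -> t ->|s -> t ->|s -> t ->|].
- by rewrite phiE.
- by rewrite -(lin_map0 fl).
- by rewrite clsD (lin_mapD fl).
- by rewrite clsN (lin_mapN fl).
- by rewrite clsZ (lin_mapZ fl).
- by rewrite clsU fU.
- by rewrite clsI fI.
- by rewrite clsM fM.
- by [].
Qed.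

End Quot.
End Terms.

(** * Vector lattices and algebras of classes of terms *)

Section FreeVL.
Variables (R : realType) (O I : Type) (Y : I -> vlType R).
Variables (mul : forall i, Y i -> Y i -> Y i) (one : forall i, Y i).
Variable phi : forall i, O -> Y i.

Definition vl_ops i : opLmod R :=
  OpLmod (@vl_sup R (Y i)) (@vl_inf R (Y i)) (@mul i) (@one i).

(** The product and the identity are arbitrary, so that the same order serves
for vector lattices, where they vanish, and for algebras. *)
Definition free_vl : Type := term_quot (Y := vl_ops) phi.
HB.instance Definition _ := GRing.Lmodule.on free_vl.
Implicit Types x y z : free_vl.

Definition free_vl_ev i : free_vl -> Y i := quot_ev (Y := vl_ops) (phi := phi) i.
Local Notation e := free_vl_ev.

Lemma free_vl_ev_inj x y : (forall i, e i x = e i y) -> x = y.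
Proof. exact: (@quot_ev_inj _ _ _ vl_ops phi x y). Qed.

Lemma free_vl_ev_linear i : linear (e i).
Proof. exact: (op_hom_linear (quot_ev_hom (Y := vl_ops) phi i)). Qed.

(** The order is that of the product of the family, in which the evaluations
embed the quotient. *)
Definition free_vl_le x y : bool := `[< forall i, e i x <= e i y >].
Let leP x y : reflect (forall i, e i x <= e i y) (free_vl_le x y).
Proof. exact: asboolP. Qed.
Let le_refl : reflexive free_vl_le.
Proof. by move=> x; apply/leP. Qed.
Let le_anti : antisymmetric free_vl_le.
Proof.
move=> x y /andP[/leP xy /leP yx]; apply: free_vl_ev_inj => i.
by apply/le_anti; rewrite xy yx.
Qed.
Let le_trans : transitive free_vl_le.
Proof. by move=> y x z /leP xy /leP yz; apply/leP => i; exact: le_trans (yz i). Qed.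

HB.instance Definition _ :=
  Order.Le_isPOrder.Build ring_display free_vl le_refl le_anti le_trans.

Lemma free_vl_leP x y : reflect (forall i, e i x <= e i y) (x <= y).
Proof. exact: leP. Qed.

Definition free_vl_sup x y : free_vl := quot_sup x y.
Definition free_vl_inf x y : free_vl := quot_inf x y.

Let leD2r z x y : x <= y -> x + z <= y + z.
Proof.
move=> /leP xy; apply/leP => i; rewrite !(lin_mapD (free_vl_ev_linear i)).
exact: vl_leD2r (xy i).
Qed.
Let leZ2l (a : R) x y : 0 <= a -> x <= y -> a *: x <= a *: y.
Proof.
move=> a0 /leP xy; apply/leP => i; rewrite !(lin_mapZ (free_vl_ev_linear i)).
exact: vl_leZ2l (xy i).
Qed.
Let eU i x y : e i (free_vl_sup x y) = vl_sup (e i x) (e i y).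
Proof. exact: (op_homU (quot_ev_hom (Y := vl_ops) phi i)). Qed.
Let eI i x y : e i (free_vl_inf x y) = vl_inf (e i x) (e i y).
Proof. exact: (op_homI (quot_ev_hom (Y := vl_ops) phi i)). Qed.
Let lexI x y z : (x <= free_vl_inf y z) = (x <= y) && (x <= z).
Proof.
apply/leP/andP => [H|[/leP xy /leP xz] i]; last by rewrite eI vl_lexI xy xz.
by split; apply/leP => i; have := H i; rewrite eI vl_lexI => /andP[].
Qed.
Let leUx x y z : (free_vl_sup x y <= z) = (x <= z) && (y <= z).
Proof.
apply/leP/andP => [H|[/leP xy /leP xz] i]; last by rewrite eU vl_leUx xy xz.
by split; apply/leP => i; have := H i; rewrite eU vl_leUx => /andP[].
Qed.

HB.instance Definition _ :=
  POrderedLmodule_isVectorLattice.Build R free_vl leD2r leZ2l lexI leUx.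

Lemma free_vl_ev_hom i : vl_hom (@e i).
Proof. by split; [exact: free_vl_ev_linear|exact: eU|exact: eI]. Qed.
End FreeVL.

Section FreeVLA.
Variables (R : realType) (O I : Type) (Y : I -> vlaType R).
Variables (one : forall i, Y i) (phi : forall i, O -> Y i).

Definition free_vla : Type := free_vl (fun i => @monoid.mul (Y i)) one phi.
HB.instance Definition _ := VectorLattice.on free_vla.
Implicit Types x y z : free_vla.

Definition free_vla_ev i : free_vla -> Y i :=
  free_vl_ev (mul := fun i => @monoid.mul (Y i)) (one := one) (phi := phi) i.
Local Notation e := free_vla_ev.

Lemma free_vla_ev_inj x y : (forall i, e i x = e i y) -> x = y.
Proof. exact: free_vl_ev_inj. Qed.

Let leP x y : reflect (forall i, e i x <= e i y) (x <= y).
Proof. exact: free_vl_leP. Qed.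

Definition free_vla_mul x y : free_vla := quot_mul x y.

Lemma free_vla_ev_vl_hom i : vl_hom (e i).
Proof. exact: free_vl_ev_hom. Qed.

Let e_lin i : linear (e i).
Proof. by have [] := free_vla_ev_vl_hom i. Qed.

Lemma free_vla_evM i x y : e i (free_vla_mul x y) = (e i x * e i y)%g.
Proof. exact: (op_homM (quot_ev_hom (Y := vl_ops _ one) phi i)). Qed.

Let mulA : associative free_vla_mul.
Proof. by move=> x y z; apply: free_vla_ev_inj => i; rewrite !free_vla_evM mulgA. Qed.

HB.instance Definition _ := isSemigroup.Build free_vla mulA.

Let mulDl x y z : ((x + y)%R * z)%g = (x * z)%g + (y * z)%g.
Proof.
apply: free_vla_ev_inj => i.
by rewrite free_vla_evM !(lin_mapD (e_lin i)) !free_vla_evM vla_mulDl.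
Qed.

Let mulDr x y z : (x * (y + z)%R)%g = (x * y)%g + (x * z)%g.
Proof.
apply: free_vla_ev_inj => i.
by rewrite free_vla_evM !(lin_mapD (e_lin i)) !free_vla_evM vla_mulDr.
Qed.

Let mulZl (a : R) x y : ((a *: x)%R * y)%g = a *: (x * y)%g.
Proof.
apply: free_vla_ev_inj => i.
by rewrite free_vla_evM !(lin_mapZ (e_lin i)) !free_vla_evM vla_mulZl.
Qed.

Let mulZr (a : R) x y : (x * (a *: y)%R)%g = a *: (x * y)%g.
Proof.
apply: free_vla_ev_inj => i.
by rewrite free_vla_evM !(lin_mapZ (e_lin i)) !free_vla_evM vla_mulZr.
Qed.

Let mul_ge0 x y : 0 <= x -> 0 <= y -> 0 <= (x * y)%g.
Proof.
move=> /leP x0 /leP y0; apply/leP => i; rewrite (lin_map0 (e_lin i)) free_vla_evM.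
by apply: vla_mul_ge0; rewrite -(lin_map0 (e_lin i)); [exact: x0|exact: y0].
Qed.

HB.instance Definition _ :=
  VectorLattice_isVLA.Build R free_vla mulDl mulDr mulZl mulZr mul_ge0.

Lemma free_vla_ev_hom i : vla_hom (e i).
Proof. by split; [exact: free_vla_ev_vl_hom|exact: free_vla_evM]. Qed.
End FreeVLA.

Section FreeUVLA.
Variables (R : realType) (O I : Type) (Y : I -> uvlaType R).
Variable phi : forall i, O -> Y i.

Definition free_uvla : Type := free_vla (fun i => 1%g : Y i) phi.
HB.instance Definition _ := VLA.on free_uvla.

Definition free_uvla_ev i : free_uvla -> Y i :=
  free_vla_ev (one := fun i => 1%g : Y i) (phi := phi) i.
Local Notation e := free_uvla_ev.

Lemma free_uvla_ev_inj (x y : free_uvla) : (forall i, e i x = e i y) -> x = y.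
Proof. exact: free_vla_ev_inj. Qed.

Lemma free_uvla_ev_vla_hom i : vla_hom (e i).
Proof. exact: free_vla_ev_hom. Qed.

Definition free_uvla_one : free_uvla := quot_one _.

Lemma free_uvla_ev1 i : e i free_uvla_one = 1%g.
Proof. exact: (op_homE (quot_ev_hom (Y := vl_ops _ (fun i => 1%g : Y i)) phi i)). Qed.

Let eM i : {morph e i : x y / (x * y)%g}.
Proof. by have [] := free_uvla_ev_vla_hom i. Qed.

Let mul1 : left_id free_uvla_one (@monoid.mul free_uvla).
Proof. by move=> x; apply: free_uvla_ev_inj => i; rewrite eM free_uvla_ev1 mul1g. Qed.

Let mulr1 : right_id free_uvla_one (@monoid.mul free_uvla).
Proof. by move=> x; apply: free_uvla_ev_inj => i; rewrite eM free_uvla_ev1 mulg1. Qed.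

HB.instance Definition _ := Semigroup_isMonoid.Build free_uvla mul1 mulr1.

Lemma free_uvla_ev_hom i : uvla_hom (e i).
Proof. by split; [exact: free_uvla_ev_vla_hom|exact: free_uvla_ev1]. Qed.
End FreeUVLA.

Section FreeUPVLA.
Variables (R : realType) (O I : Type) (Y : I -> upvlaType R).
Variable phi : forall i, O -> Y i.

Definition free_upvla : Type := free_uvla phi.
HB.instance Definition _ := UVLA.on free_upvla.

Let one_ge0 : 0 <= (1%g : free_upvla).
Proof.
apply/free_vl_leP => i; have [[[lin _ _] _] e1] := free_uvla_ev_hom phi i.
by rewrite [free_vl_ev _ 0](lin_map0 lin) [free_vl_ev _ _]e1 uvla_one_ge0.
Qed.

HB.instance Definition _ := UVLA_hasPositiveOne.Build R free_upvla one_ge0.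
End FreeUPVLA.

(** * Existence of the free objects *)

(** This is what the construction needs to know about the source category, in
order that the map from [O] to the quotient be one of its morphisms. It holds
whenever morphisms are the maps that preserve some operations, because an
equation in [F] can be checked in all the [Y i]. *)
Definition jointly_reflected (O C : Type) (car : C -> Type)
    (hom1 : forall Y : C, (O -> car Y) -> Prop)
    (hom2 : forall X Y : C, (car X -> car Y) -> Prop) : Prop :=
  forall (F : C) (j : O -> car F) (I : Type) (Y : I -> C)
    (e : forall i, car F -> car (Y i)),
    (forall i, hom2 F (Y i) (e i)) ->
    (forall x y, (forall i, e i x = e i y) -> x = y) ->
    (forall i, hom1 (Y i) (e i \o j)) -> hom1 F j.

Section FreeExistence.
Variables (R : realType) (O : Type).

(** The index set of the construction consists of all admissible maps from [O]
to all objects of the target category. *)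
Section Family.
Variables (C : Type) (car : C -> Type).
Variable hom1 : forall Y : C, (O -> car Y) -> Prop.
Variable hom2 : forall X Y : C, (car X -> car Y) -> Prop.

Definition hom_index : Type := {Y : C & {phi : O -> car Y | hom1 phi}}.
Definition hom_target (i : hom_index) : C := projT1 i.
Definition hom_map (i : hom_index) : O -> car (hom_target i) := sval (projT2 i).

Lemma free_object_family (F : C) (j : O -> car F)
    (e : forall i : hom_index, car F -> car (hom_target i)) :
  jointly_reflected hom1 hom2 ->
  (forall i, hom2 (e i)) ->
  (forall x y, (forall i, e i x = e i y) -> x = y) ->
  (forall i, @hom_map i = @e i \o j) ->
  (forall i f, hom2 f -> @hom_map i = f \o j -> @e i = f) ->
  free_object hom1 hom2 j.
Proof.
move=> refl e_hom e_inj ej e_uniq; split.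
  by apply: (refl F j _ _ e) => // i; rewrite -ej; exact: svalP (projT2 i).
move=> O2 phi phi1.
pose i : hom_index := existT _ O2 (exist _ phi phi1).
exists (e i); split; first by split; [exact: (e_hom i)|exact: (ej i)].
by move=> f [f2 fj]; exact: (e_uniq i).
Qed.

End Family.

(** In this proof and the next two, [Q0] says that a linear map respects the
operations that are interpreted as zero: they are zero on classes as well,
because all their evaluations vanish. *)
Lemma free_vs_exists (hom1 : forall Y : lmodType R, (O -> Y) -> Prop) :
  jointly_reflected hom1 (@vs_hom R) ->
  exists (F : lmodType R) (j : O -> F), free_object hom1 (@vs_hom R) j.
Proof.
move=> refl; pose Y (i : hom_index hom1) : opLmod R :=
  @OpLmod R (hom_target i) (fun _ _ => 0) (fun _ _ => 0) (fun _ _ => 0) 0.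
pose phi (i : hom_index hom1) : O -> Y i := hom_map i.
exists (term_quot phi), (@quot_gen _ _ _ Y phi).
apply: (@free_object_family _ _ hom1 _ (term_quot phi : lmodType R)
  (@quot_gen _ _ _ Y phi) (quot_ev (Y := Y) (phi := phi)) refl).
- by move=> i; exact: op_hom_linear (quot_ev_hom phi i).
- exact: quot_ev_inj.
- by move=> i; exact/esym/(quot_ev_gen phi).
move=> i f flin fj; apply: (quot_ev_unique (Y := Y)) => //.
have Q0 (x : term_quot phi) : (forall i, quot_ev i x = 0) -> f x = 0.
  move=> x0; rewrite (_ : x = 0) ?(lin_map0 flin)//; apply: quot_ev_inj => k.
  by rewrite x0 (lin_map0 (op_hom_linear (quot_ev_hom phi k))).
split=> [|x y|x y|x y|]; [exact: flin|..]; apply: Q0 => k; exact: quot_evE.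
Qed.

Lemma free_vl_exists (hom1 : forall Y : vlType R, (O -> Y) -> Prop) :
  jointly_reflected hom1 (@vl_hom R) ->
  exists (F : vlType R) (j : O -> F), free_object hom1 (@vl_hom R) j.
Proof.
move=> refl; pose Y (i : hom_index hom1) : vlType R := hom_target i.
pose phi (i : hom_index hom1) : O -> Y i := hom_map i.
pose mul (i : hom_index hom1) (x y : Y i) : Y i := 0.
pose one (i : hom_index hom1) : Y i := 0.
pose F : vlType R := free_vl mul one phi.
pose j : O -> F := @quot_gen _ _ _ (vl_ops mul one) phi.
exists F, j.
apply: (@free_object_family _ _ hom1 _ F j
  (free_vl_ev (mul := mul) (one := one) (phi := phi)) refl).
- exact: free_vl_ev_hom.
- exact: free_vl_ev_inj.
- by move=> i; exact/esym/(quot_ev_gen (Y := vl_ops mul one) phi).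
move=> i f [flin fU fI] fj; apply: (quot_ev_unique (Y := vl_ops mul one)) => //.
have Q0 (x : F) : (forall i, quot_ev (Y := vl_ops mul one) i x = 0) -> f x = 0.
  move=> x0; rewrite (_ : x = 0) ?(lin_map0 flin)//; apply: free_vl_ev_inj => k.
  by rewrite [LHS]x0 (lin_map0 (free_vl_ev_linear k)).
split=> [|x y|x y|x y|]; [exact: flin|exact: fU|exact: fI|..];
  apply: Q0 => k; exact: quot_evE.
Qed.

Lemma free_vla_exists (hom1 : forall Y : vlaType R, (O -> Y) -> Prop) :
  jointly_reflected hom1 (@vla_hom R) ->
  exists (F : vlaType R) (j : O -> F), free_object hom1 (@vla_hom R) j.
Proof.
move=> refl; pose Y (i : hom_index hom1) : vlaType R := hom_target i.
pose phi (i : hom_index hom1) : O -> Y i := hom_map i.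
pose mul (i : hom_index hom1) (x y : Y i) : Y i := (x * y)%g.
pose one (i : hom_index hom1) : Y i := 0.
pose F : vlaType R := free_vla one phi.
pose j : O -> F := @quot_gen _ _ _ (vl_ops mul one) phi.
exists F, j.
apply: (@free_object_family _ _ hom1 _ F j (free_vla_ev (one := one) (phi := phi)) refl).
- exact: free_vla_ev_hom.
- exact: free_vla_ev_inj.
- by move=> i; exact/esym/(quot_ev_gen (Y := vl_ops mul one) phi).
move=> i f [[flin fU fI] fM] fj; apply: (quot_ev_unique (Y := vl_ops mul one)) => //.
have Q0 (x : F) : (forall i, quot_ev (Y := vl_ops mul one) i x = 0) -> f x = 0.
  move=> x0; rewrite (_ : x = 0) ?(lin_map0 flin)//; apply: free_vl_ev_inj => k.
  by rewrite [LHS]x0 (lin_map0 (free_vl_ev_linear k)).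
split; [exact: flin|exact: fU|exact: fI|exact: fM|]; apply: Q0 => k; exact: quot_evE.
Qed.

Lemma free_uvla_exists (hom1 : forall Y : uvlaType R, (O -> Y) -> Prop) :
  jointly_reflected hom1 (@uvla_hom R) ->
  exists (F : uvlaType R) (j : O -> F), free_object hom1 (@uvla_hom R) j.
Proof.
move=> refl; pose Y (i : hom_index hom1) : uvlaType R := hom_target i.
pose phi (i : hom_index hom1) : O -> Y i := hom_map i.
pose mul (i : hom_index hom1) (x y : Y i) : Y i := (x * y)%g.
pose one (i : hom_index hom1) : Y i := 1%g.
pose F : uvlaType R := free_uvla phi.
pose j : O -> F := @quot_gen _ _ _ (vl_ops mul one) phi.
exists F, j.
apply: (@free_object_family _ _ hom1 _ F j (free_uvla_ev (phi := phi)) refl).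
- exact: free_uvla_ev_hom.
- exact: free_uvla_ev_inj.
- by move=> i; exact/esym/(quot_ev_gen (Y := vl_ops mul one) phi).
move=> i f [[[flin fU fI] fM] f1] fj.
by apply: (quot_ev_unique (Y := vl_ops mul one)).
Qed.

Lemma free_upvla_exists (hom1 : forall Y : upvlaType R, (O -> Y) -> Prop) :
  jointly_reflected hom1 (@upvla_hom R) ->
  exists (F : upvlaType R) (j : O -> F), free_object hom1 (@upvla_hom R) j.
Proof.
move=> refl; pose Y (i : hom_index hom1) : upvlaType R := hom_target i.
pose phi (i : hom_index hom1) : O -> Y i := hom_map i.
pose mul (i : hom_index hom1) (x y : Y i) : Y i := (x * y)%g.
pose one (i : hom_index hom1) : Y i := 1%g.
pose F : upvlaType R := free_upvla phi.
pose j : O -> F := @quot_gen _ _ _ (vl_ops mul one) phi.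
exists F, j.
apply: (@free_object_family _ _ hom1 _ F j (free_uvla_ev (phi := phi)) refl).
- exact: free_uvla_ev_hom.
- exact: free_uvla_ev_inj.
- by move=> i; exact/esym/(quot_ev_gen (Y := vl_ops mul one) phi).
move=> i f [[[flin fU fI] fM] f1] fj.
by apply: (quot_ev_unique (Y := vl_ops mul one)).
Qed.

End FreeExistence.

Section Reflection.
Variables (R : realType).

Lemma vs_hom_reflected (V F : lmodType R) (j : V -> F) (I : Type)
    (Y : I -> lmodType R) (e : forall i, F -> Y i) :
  (forall i, linear (e i)) -> (forall x y, (forall i, e i x = e i y) -> x = y) ->
  (forall i, linear (e i \o j)) -> linear j.
Proof.
move=> elin einj ejlin a x y; apply: einj => i.
by rewrite elin; exact: ejlin.
Qed.

Lemma vl_hom_reflected (E F : vlType R) (j : E -> F) (I : Type)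
    (Y : I -> vlType R) (e : forall i, F -> Y i) :
  (forall i, vl_hom (e i)) -> (forall x y, (forall i, e i x = e i y) -> x = y) ->
  (forall i, vl_hom (e i \o j)) -> vl_hom j.
Proof.
move=> ehom einj ejhom; split.
- by apply: (vs_hom_reflected (e := e)) => // i;
    [have [] := ehom i|have [] := ejhom i].
- move=> x y; apply: einj => i; have [_ eU _] := ehom i.
  by have [_ ejU _] := ejhom i; rewrite eU; exact: ejU.
- move=> x y; apply: einj => i; have [_ _ eI] := ehom i.
  by have [_ _ ejI] := ejhom i; rewrite eI; exact: ejI.
Qed.

Lemma vla_hom_reflected (A F : vlaType R) (j : A -> F) (I : Type)
    (Y : I -> vlaType R) (e : forall i, F -> Y i) :
  (forall i, vla_hom (e i)) -> (forall x y, (forall i, e i x = e i y) -> x = y) ->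
  (forall i, vla_hom (e i \o j)) -> vla_hom j.
Proof.
move=> ehom einj ejhom; split.
  by apply: (vl_hom_reflected (e := e)) => // i;
    [have [] := ehom i|have [] := ejhom i].
move=> x y; apply: einj => i; have [_ eM] := ehom i.
by have [_ ejM] := ejhom i; rewrite eM; exact: ejM.
Qed.

Lemma uvla_hom_reflected (A F : uvlaType R) (j : A -> F) (I : Type)
    (Y : I -> uvlaType R) (e : forall i, F -> Y i) :
  (forall i, uvla_hom (e i)) -> (forall x y, (forall i, e i x = e i y) -> x = y) ->
  (forall i, uvla_hom (e i \o j)) -> uvla_hom j.
Proof.
move=> ehom einj ejhom; split.
  by apply: (vla_hom_reflected (e := e)) => // i;
    [have [] := ehom i|have [] := ejhom i].
by apply: einj => i; have [_ e1] := ehom i; have [_ ej1] := ejhom i; rewrite e1 -ej1.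
Qed.

End Reflection.

Section Existence.
Variables (R : realType) (S : Type) (V : lmodType R) (E : vlType R).
Variables (A : vlaType R) (A1 : uvlaType R).

Lemma exists_free_Set :
  [/\ (exists (F : lmodType R) (j : S -> F), free_Set_VS j),
      (exists (F : vlType R) (j : S -> F), free_Set_VL j),
      (exists (F : vlaType R) (j : S -> F), free_Set_VLA j),
      (exists (F : uvlaType R) (j : S -> F), free_Set_UVLA j)
    & (exists (F : upvlaType R) (j : S -> F), free_Set_UPVLA j)].
Proof.
split; [exact: free_vs_exists|exact: free_vl_exists|exact: free_vla_exists|
  exact: free_uvla_exists|exact: free_upvla_exists].
Qed.

Lemma exists_free_VS :
  [/\ (exists (F : vlType R) (j : V -> F), free_VS_VL j),
      (exists (F : vlaType R) (j : V -> F), free_VS_VLA j),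
      (exists (F : uvlaType R) (j : V -> F), free_VS_UVLA j)
    & (exists (F : upvlaType R) (j : V -> F), free_VS_UPVLA j)].
Proof.
split; [apply: free_vl_exists|apply: free_vla_exists|
  apply: free_uvla_exists|apply: free_upvla_exists] => F j I Y e ehom einj ejhom;
  apply: (vs_hom_reflected (e := e)) => // i.
- exact: vl_homW (ehom i).
- exact/vl_homW/vla_homW/(ehom i).
- exact/vl_homW/vla_homW/uvla_homW/(ehom i).
- exact/vl_homW/vla_homW/uvla_homW/(ehom i).
Qed.

Lemma exists_free_VL :
  [/\ (exists (F : vlaType R) (j : E -> F), free_VL_VLA j),
      (exists (F : uvlaType R) (j : E -> F), free_VL_UVLA j)
    & (exists (F : upvlaType R) (j : E -> F), free_VL_UPVLA j)].
Proof.
split; [apply: free_vla_exists|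
  apply: free_uvla_exists|apply: free_upvla_exists] => F j I Y e ehom einj ejhom;
  apply: (vl_hom_reflected (e := e)) => // i.
- exact: vla_homW (ehom i).
- exact/vla_homW/uvla_homW/(ehom i).
- exact/vla_homW/uvla_homW/(ehom i).
Qed.

Lemma exists_free_VLA :
  (exists (F : uvlaType R) (j : A -> F), free_VLA_UVLA j) /\
  (exists (F : upvlaType R) (j : A -> F), free_VLA_UPVLA j).
Proof.
split; [apply: free_uvla_exists|apply: free_upvla_exists] => F j I Y e ehom einj ejhom;
  apply: (vla_hom_reflected (e := e)) => // i; exact: uvla_homW (ehom i).
Qed.

Lemma exists_free_UVLA : exists (F : upvlaType R) (j : A1 -> F), free_UVLA_UPVLA j.
Proof.
apply: free_upvla_exists => F j I Y e ehom einj ejhom.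
exact: (uvla_hom_reflected (e := e)).
Qed.
End Existence.

(** * Maps out of a free object *)

Section FreeObjectTheory.
Variables (O C : Type) (car : C -> Type).
Variable hom1 : forall Y : C, (O -> car Y) -> Prop.
Variable hom2 : forall X Y : C, (car X -> car Y) -> Prop.
Variables (F : C) (j : O -> car F).
Hypothesis Fj : free_object hom1 hom2 j.

Lemma free_lift (Y : C) (phi : O -> car Y) : hom1 phi ->
  exists2 f : car F -> car Y, hom2 f & f \o j = phi.
Proof. by move=> /(Fj.2)[f [[f2 fj] _]]; exists f. Qed.

Lemma free_ext (Y : C) (f g : car F -> car Y) :
  hom1 (f \o j) -> hom2 f -> hom2 g -> f \o j = g \o j -> f = g.
Proof.
move=> f1 f2 g2 fg; have [k [_ k_uniq]] := Fj.2 _ _ f1.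
by rewrite -(k_uniq f) ?(k_uniq g).
Qed.

Lemma free_injective :
  (forall x y, x <> y -> exists (Y : C) (phi : O -> car Y), hom1 phi /\ phi x <> phi y) ->
  injective j.
Proof.
move=> sep x y jxy; apply: contrapT => /sep[Y [phi [phi1]]]; apply.
by have [f _ <-] := free_lift phi1; rewrite /= jxy.
Qed.

Hypothesis hom1_comp : forall (X Y : C) (phi : O -> car X) (f : car X -> car Y),
  hom1 phi -> hom2 f -> hom1 (f \o phi).
Hypothesis hom2_comp : forall (X Y Z : C) (f : car X -> car Y) (g : car Y -> car Z),
  hom2 f -> hom2 g -> hom2 (g \o f).

(** A homomorphism [u] on [F] whose restriction to the generators extends to
[F'] factors through the canonical map, by the uniqueness of extensions from
[F]. So the canonical map separates the points that such homomorphisms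
separate. *)
Lemma free_canonical_injective (F' : C) (j' : O -> car F') : hom1 j' ->
  (forall x y, x <> y -> exists (Z : C) (u : car F -> car Z) (g : car F' -> car Z),
     [/\ hom2 u, hom2 g, g \o j' = u \o j & u x <> u y]) ->
  canonical_injective (@hom2 F F') j j'.
Proof.
move=> j'1 sep; have [psi psiP] := Fj.2 _ _ j'1; exists psi; split=> // x y psixy.
have [[psi2 psij] _] := psiP.
apply: contrapT => /sep[Z [u [g [u2 g2 gu]]]]; apply.
suff <- : g \o psi = u by rewrite /= psixy.
apply: free_ext => //; last by rewrite -gu psij.
  by rewrite -compA -psij; exact: hom1_comp.
exact: hom2_comp psi2 g2.
Qed.
End FreeObjectTheory.

(** * Separating points by homomorphisms *)

Section RealLine.
Variable R : realType.

(** A copy of [R^o] that carries the order of [R]. *)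
Definition real_line : Type := R^o.
HB.instance Definition _ := GRing.Lmodule.copy real_line R^o.
HB.instance Definition _ := Order.POrder.copy real_line R.

Let leD2r (z x y : real_line) : x <= y -> x + z <= y + z.
Proof. by rewrite (@lerD2r R). Qed.
Let leZ2l (a : R) (x y : real_line) : 0 <= a -> x <= y -> a *: x <= a *: y.
Proof. by move=> a0 xy; exact: (@ler_wpM2l R). Qed.
Let lexI (x y z : real_line) : (x <= (Num.min y z : real_line)) = (x <= y) && (x <= z).
Proof. exact: (@le_min _ R). Qed.
Let leUx (x y z : real_line) : ((Num.max x y : real_line) <= z) = (x <= z) && (y <= z).
Proof. exact: (@ge_max _ R). Qed.

HB.instance Definition _ :=
  POrderedLmodule_isVectorLattice.Build R real_line leD2r leZ2l lexI leUx.
End RealLine.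

Section Separation.
Variables (R : realType) (V : lmodType R).

(** The functional is the coordinate along [v] relative to a hyperplane that
does not contain [v]; such a hyperplane is a maximal subspace among those that
avoid [v]. *)
Lemma separating_functional (v : V) : v != 0 ->
  exists2 f : V -> real_line R, linear f & f v != 0.
Proof.
move=> v0.
pose P (U : set V) := (forall (a : R) x y, U x -> U y -> U (a *: x + y)) /\ ~ U v.
(* The empty set belongs to P, so that the empty chain is no exception; that a
   maximal member contains 0 has to be derived from maximality. *)
have [U [[Ulin Uv] Umax]] : exists U, P U /\ forall B, U `<` B -> ~ P B.
  apply: Zorn_bigcup => F FP Ftot; split=> [a x y [U FU Ux] [W FW Wy]|[U /FP[] //]].
  have [UW|WU] := Ftot _ _ FU FW.
    by exists W => //; apply: (FP _ FW).1 => //; exact: UW.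
  by exists U => //; apply: (FP _ FU).1 => //; exact: WU.
have max (W : set V) : U `<=` W -> P W -> W `<=` U.
  by move=> UW PW; apply: contrapT => WU; exact: (Umax W).
have U0 : U 0.
  apply: (max (fun z => U z \/ z = 0)); [by left| |by right].
  split=> [a x y [Ux|->] [Uy|->]|[//|/eqP]]; last by rewrite (negPf v0).
  - by left; exact: Ulin.
  - by left; have := Ulin (-1) _ _ Ux Ux; rewrite scaleN1r addNr; exact: Ulin.
  - by left; rewrite scaler0 add0r.
  - by right; rewrite scaler0 addr0.
have UZ a x : U x -> U (a *: x) by move=> Ux; rewrite -[_ *: _]addr0; exact: Ulin.
have UD x y : U x -> U y -> U (x + y).
  by move=> Ux Uy; rewrite -[x]scale1r; exact: Ulin.
(* Otherwise adjoining x to U would give a larger subspace that avoids v. *)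
have decomp x : exists a : R, U (x - a *: v).
  apply: contrapT => nx.
  suff Ux : U x by apply: nx; exists 0; rewrite scale0r subr0.
  apply: (max (fun z => exists b : R, U (z - b *: x))) => [z Uz||].
  - by exists 0; rewrite scale0r subr0.
  - split=> [a y z [b Uy] [c Uz]|[b Ub]].
      exists (a * b + c); rewrite scalerDl opprD addrACA -scalerA -scalerBr.
      exact: Ulin.
    have [b0|b0] := eqVneq b 0; first by apply: Uv; move: Ub; rewrite b0 scale0r subr0.
    apply: nx; exists b^-1; have := UZ (- b^-1) _ Ub.
    by rewrite scalerBr !scaleNr opprK scalerA mulVf// scale1r addrC.
  - by exists 1; rewrite scale1r subrr.
have uniq x (a b : R) : U (x - a *: v) -> U (x - b *: v) -> a = b.
  move=> Ua Ub; apply/eqP; rewrite -subr_eq0; apply/negPn/negP => ab0.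
  have := UD _ _ (UZ (-1) _ Ua) Ub.
  rewrite scaleN1r opprB subrKA -scalerBl => /(UZ (a - b)^-1).
  by rewrite scalerA mulVf// scale1r.
pose f x : real_line R := xget 0 [set a : R | U (x - a *: v)].
have fP x : U (x - (f x : R) *: v).
  have [a Ua] := decomp x.
  exact: (@xgetPex _ 0 [set a : R | U (x - a *: v)]) (ex_intro _ a Ua).
exists f => [a x y|].
  apply: (uniq (a *: x + y)); first exact: fP.
  rewrite scalerDl opprD addrACA -scalerA -scalerBr; exact: Ulin.
rewrite (_ : f v = 1 :> R) ?oner_neq0//; apply: (uniq v); first exact: fP.
by rewrite scale1r subrr.
Qed.

End Separation.

Section ZeroProduct.
Variables (R : realType) (E : vlType R).

Definition zero_vla : Type := E.
HB.instance Definition _ := VectorLattice.on zero_vla.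

Let mul0A : associative (fun _ _ : zero_vla => 0 : zero_vla).
Proof. by []. Qed.
HB.instance Definition _ := isSemigroup.Build zero_vla mul0A.

Let mulDl (x y z : zero_vla) : ((x + y)%R * z)%g = (x * z)%g + (y * z)%g.
Proof. exact/esym/addr0. Qed.
Let mulDr (x y z : zero_vla) : (x * (y + z)%R)%g = (x * y)%g + (x * z)%g.
Proof. exact/esym/addr0. Qed.
Let mulZl (a : R) (x y : zero_vla) : ((a *: x)%R * y)%g = a *: (x * y)%g.
Proof. exact/esym/scaler0. Qed.
Let mulZr (a : R) (x y : zero_vla) : (x * (a *: y)%R)%g = a *: (x * y)%g.
Proof. exact/esym/scaler0. Qed.
Let mul_ge0 (x y : zero_vla) : 0 <= x -> 0 <= y -> 0 <= (x * y)%g.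
Proof. by move=> _ _; exact: (lexx (0 : E)). Qed.

HB.instance Definition _ :=
  VectorLattice_isVLA.Build R zero_vla mulDl mulDr mulZl mulZr mul_ge0.
End ZeroProduct.

Section Unitization.
Variables (R : realType) (A : vlaType R).

(** The factor [R] is the line spanned by the adjoined identity element; the
order is coordinatewise, so that the identity is positive and [A] is a
sublattice. *)
Definition unitization : Type := (A * real_line R)%type.
HB.instance Definition _ := GRing.Lmodule.on unitization.
Implicit Types x y z : unitization.

Definition unitization_le x y : bool := (x.1 <= y.1) && (x.2 <= y.2).

Let le_refl : reflexive unitization_le.
Proof. by move=> x; rewrite /unitization_le !lexx. Qed.
Let le_anti : antisymmetric unitization_le.
Proof.
move=> [x a] [y b] /andP[/andP[/= xy ab] /andP[/= yx ba]].
by congr pair; apply/le_anti; rewrite ?xy ?ab.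
Qed.
Let le_trans : transitive unitization_le.
Proof.
move=> y x z /andP[xy1 xy2] /andP[yz1 yz2]; apply/andP.
by split; [exact: le_trans yz1|exact: le_trans yz2].
Qed.
HB.instance Definition _ :=
  Order.Le_isPOrder.Build ring_display unitization le_refl le_anti le_trans.

Definition unitization_sup x y : unitization := (vl_sup x.1 y.1, vl_sup x.2 y.2).
Definition unitization_inf x y : unitization := (vl_inf x.1 y.1, vl_inf x.2 y.2).

Let leD2r z x y : x <= y -> x + z <= y + z.
Proof. by move=> /andP[xy1 xy2]; apply/andP; split; exact: vl_leD2r. Qed.
Let leZ2l (a : R) x y : 0 <= a -> x <= y -> a *: x <= a *: y.
Proof. by move=> a0 /andP[xy1 xy2]; apply/andP; split; exact: vl_leZ2l. Qed.
Let lexI x y z : (x <= unitization_inf y z) = (x <= y) && (x <= z).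
Proof. by rewrite {1}/Order.le /= /unitization_le /= !vl_lexI andbACA. Qed.
Let leUx x y z : (unitization_sup x y <= z) = (x <= z) && (y <= z).
Proof. by rewrite {1}/Order.le /= /unitization_le /= !vl_leUx andbACA. Qed.

HB.instance Definition _ :=
  POrderedLmodule_isVectorLattice.Build R unitization leD2r leZ2l lexI leUx.

Definition unitization_mul x y : unitization :=
  ((x.1 * y.1)%g + (x.2 *: y.1 + y.2 *: x.1), (x.2 : R) * (y.2 : R) : real_line R).

Let mulA : associative unitization_mul.
Proof.
move=> [x a] [y b] [z c]; congr pair => /=; last by rewrite mulrA.
rewrite !vla_mulDl !vla_mulDr !vla_mulZl !vla_mulZr !scalerDr !scalerA mulgA.
rewrite -!addrA; congr (_ + _).
rewrite [RHS]addrCA; congr (_ + _).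
rewrite [X in _ = _ + X]addrCA [RHS]addrCA; congr (_ + _).
by rewrite (mulrC (c : R) a) (mulrC (c : R) b).
Qed.

HB.instance Definition _ := isSemigroup.Build unitization mulA.

Let mulDl x y z : ((x + y)%R * z)%g = (x * z)%g + (y * z)%g.
Proof.
congr pair; rewrite /= ?mulrDl// vla_mulDl scalerDl scalerDr.
by rewrite (addrACA (_ *: _)) [RHS]addrACA.
Qed.

Let mulDr x y z : (x * (y + z)%R)%g = (x * y)%g + (x * z)%g.
Proof.
congr pair; rewrite /= ?mulrDr// vla_mulDr scalerDl scalerDr.
by rewrite (addrACA (_ *: _)) [RHS]addrACA.
Qed.

Let mulZl (a : R) x y : ((a *: x)%R * y)%g = a *: (x * y)%g.
Proof.
congr pair; rewrite /= -?mulrA// vla_mulZl !scalerDr !scalerA.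
by rewrite (mulrC a (y.2 : R)).
Qed.

Let mulZr (a : R) x y : (x * (a *: y)%R)%g = a *: (x * y)%g.
Proof.
congr pair => /=; last by rewrite mulrCA.
rewrite vla_mulZr !scalerDr !scalerA.
by rewrite (mulrC a (x.2 : R)).
Qed.

Let mul_ge0 x y : 0 <= x -> 0 <= y -> 0 <= (x * y)%g.
Proof.
have D0 (u v : A) : 0 <= u -> 0 <= v -> 0 <= u + v.
  by move=> u0 v0; have := vl_leD2r v _ _ u0; rewrite add0r;
    exact: Order.POrderTheory.le_trans.
have Z0 (a : R) (u : A) : 0 <= a -> 0 <= u -> 0 <= a *: u.
  by move=> a0 u0; rewrite -(scaler0 _ a); exact: vl_leZ2l.
move=> /andP[x1 x2] /andP[y1 y2]; apply/andP; split; last exact: (@mulr_ge0 R).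
by apply: (D0); [exact: vla_mul_ge0|apply: (D0); exact: (Z0)].
Qed.

HB.instance Definition _ :=
  VectorLattice_isVLA.Build R unitization mulDl mulDr mulZl mulZr mul_ge0.

Definition unitization_one : unitization := (0, 1 : R).

Let A0x (x : A) : (0 * x)%g = 0 :> A.
Proof. by have := vla_mulZl 0 0 x; rewrite !scale0r. Qed.
Let Ax0 (x : A) : (x * 0)%g = 0 :> A.
Proof. by have := vla_mulZr 0 x 0; rewrite !scale0r. Qed.

Let mul1 : left_id unitization_one (@monoid.mul unitization).
Proof.
move=> [x a]; congr pair; rewrite /= ?mul1r//.
by rewrite A0x scale1r scaler0 add0r addr0.
Qed.
Let mulr1 : right_id unitization_one (@monoid.mul unitization).
Proof.
move=> [x a]; congr pair; rewrite /= ?mulr1//.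
by rewrite Ax0 scale1r scaler0 !add0r.
Qed.
HB.instance Definition _ := Semigroup_isMonoid.Build unitization mul1 mulr1.

Let one_ge0 : 0 <= (1%g : unitization).
Proof. by apply/andP; split; [exact: lexx|exact: (@ler01 R)]. Qed.
HB.instance Definition _ := UVLA_hasPositiveOne.Build R unitization one_ge0.

Definition unitization_incl (x : A) : unitization := (x, 0 : R).

Lemma unitization_incl_inj : injective unitization_incl.
Proof. by move=> x y []. Qed.

Lemma unitization_incl_hom : vla_hom unitization_incl.
Proof.
split; first split.
- by move=> a x y; congr pair; rewrite /= scaler0 addr0.
- by move=> x y; congr pair; exact: esym (@maxxx _ R 0).
- by move=> x y; congr pair; exact: esym (@minxx _ R 0).
by move=> x y; congr pair; rewrite /= ?mulr0// !scale0r !addr0.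
Qed.

End Unitization.

(** * Injectivity of the canonical maps *)

Section Injectivity.
Variables (R : realType) (O : Type).

(** With the zero product, [F3] itself is a vector lattice algebra, so the
identity of [F3] extends to [F4] and is a left inverse of the canonical map. *)
Lemma vl_vla_canonical_injective (hom1 : forall Y : vlType R, (O -> Y) -> Prop)
    (F3 : vlType R) (F4 : vlaType R) (j3 : O -> F3) (j4 : O -> F4) :
  (forall (X Y : vlType R) (phi : O -> X) (f : X -> Y),
     hom1 X phi -> vl_hom f -> hom1 Y (f \o phi)) ->
  free_object hom1 (@vl_hom R) j3 ->
  free_object (fun Y : vlaType R => hom1 Y) (@vla_hom R) j4 ->
  canonical_injective (@vl_hom R F3 F4) j3 j4.
Proof.
move=> comp1 free3 free4.
apply: (free_canonical_injective free3 comp1 (@vl_hom_comp R) free4.1) => x y xy.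
(* [F3] and the vector lattice underlying [zero_vla F3] have the same
   operations, but they are not the same object: the identity map is needed
   as a morphism between them. *)
have id_hom : vl_hom (idfun : F3 -> zero_vla F3) by [].
have [g g2 gj] := free_lift free4 (Y := zero_vla F3) (comp1 _ _ _ _ free3.1 id_hom).
exists (zero_vla F3 : vlType R), idfun, g.
by split=> //; exact: vla_homW g2.
Qed.

Section Units.
Variable hom1 : forall Y : vlaType R, (O -> Y) -> Prop.
Hypothesis comp1 : forall (X Y : vlaType R) (phi : O -> X) (f : X -> Y),
  hom1 phi -> vla_hom f -> hom1 (f \o phi).

Variables (F4 : vlaType R) (j4 : O -> F4).
Hypothesis free4 : free_object hom1 (@vla_hom R) j4.

Let unitization_hom1 : hom1 (@unitization_incl R F4 \o j4).
Proof. by apply: comp1; [exact: free4.1|exact: unitization_incl_hom]. Qed.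

(** The embedding of [F4] in its unitization factors through [F5]. *)
Lemma vla_uvla_canonical_injective (F5 : uvlaType R) (j5 : O -> F5) :
  free_object (fun Y : uvlaType R => @hom1 Y) (@uvla_hom R) j5 ->
  canonical_injective (@vla_hom R F4 F5) j4 j5.
Proof.
move=> free5.
apply: (free_canonical_injective free4 comp1 (@vla_hom_comp R) free5.1) => x y xy.
have [g g2 gj] := free_lift free5 (Y := unitization F4) unitization_hom1.
exists (unitization F4), (@unitization_incl R F4), g.
split; [exact: unitization_incl_hom|exact: uvla_homW g2|exact: gj|
  by move/unitization_incl_inj].
Qed.

Lemma vla_upvla_canonical_injective (F6 : upvlaType R) (j6 : O -> F6) :
  free_object (fun Y : upvlaType R => @hom1 Y) (@upvla_hom R) j6 ->
  canonical_injective (@vla_hom R F4 F6) j4 j6.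
Proof.
move=> free6.
apply: (free_canonical_injective free4 comp1 (@vla_hom_comp R) free6.1) => x y xy.
have [g g2 gj] := free_lift free6 (Y := unitization F4) unitization_hom1.
exists (unitization F4), (@unitization_incl R F4), g.
split; [exact: unitization_incl_hom|exact: uvla_homW g2|exact: gj|
  by move/unitization_incl_inj].
Qed.
End Units.
End Injectivity.

Section MapsFromSources.
Variable R : realType.

Lemma free_Set_VS_injective (S : Type) (F2 : lmodType R) (j2 : S -> F2) :
  free_Set_VS j2 -> injective j2.
Proof.
move=> free2; apply: (free_injective free2) => x y xy.
exists R^o, (fun s => if `[< s = x >] then 1 else 0); split=> //.
case: asboolP => // _; case: asboolP => [yx|_]; first by case: xy.
by move/eqP; rewrite oner_eq0.
Qed.

(** Here the functionals are on the free vector space; their restrictions to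
[S] extend to the free vector lattice. *)
Lemma free_Set_VS_VL_injective (S : Type) (F2 : lmodType R) (F3 : vlType R)
    (j2 : S -> F2) (j3 : S -> F3) :
  free_Set_VS j2 -> free_Set_VL j3 -> canonical_injective (@vs_hom R F2 F3) j2 j3.
Proof.
move=> free2 free3.
apply: (free_canonical_injective free2 _ (@vs_hom_comp R) free3.1) => // x y xy.
have xy0 : x - y != 0 by rewrite subr_eq0; apply/eqP.
have [u u2 uxy] := separating_functional xy0.
have [g g2 gj] := free_lift free3 (Y := real_line R) (phi := u \o j2) I.
exists (real_line R : lmodType R), u, g; split=> //; first exact: vl_homW g2.
by apply/eqP; rewrite -subr_eq0 -(lin_mapB u2).
Qed.

(** A linear functional is an admissible map to the vector lattice [R]. *)
Lemma free_VS_VL_injective (V : lmodType R) (F3 : vlType R) (j3 : V -> F3) :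
  free_VS_VL j3 -> injective j3.
Proof.
move=> free3; apply: (free_injective free3) => x y xy.
have xy0 : x - y != 0 by rewrite subr_eq0; apply/eqP.
have [u u2 uxy] := separating_functional xy0.
by exists (real_line R), u; split=> //; apply/eqP; rewrite -subr_eq0 -(lin_mapB u2).
Qed.

Lemma free_VL_VLA_injective (E : vlType R) (F4 : vlaType R) (j4 : E -> F4) :
  free_VL_VLA j4 -> injective j4.
Proof.
move=> free4; apply: (free_injective free4) => x y xy.
by exists (zero_vla E), idfun.
Qed.

Lemma free_VLA_UVLA_injective (A : vlaType R) (F5 : uvlaType R) (j5 : A -> F5) :
  free_VLA_UVLA j5 -> injective j5.
Proof.
move=> free5; apply: (free_injective free5) => x y xy.
exists (unitization A), (@unitization_incl R A); split; first exact: unitization_incl_hom.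
by move/unitization_incl_inj.
Qed.

Lemma free_VLA_UPVLA_injective (A : vlaType R) (F6 : upvlaType R) (j6 : A -> F6) :
  free_VLA_UPVLA j6 -> injective j6.
Proof.
move=> free6; apply: (free_injective free6) => x y xy.
exists (unitization A), (@unitization_incl R A); split; first exact: unitization_incl_hom.
by move/unitization_incl_inj.
Qed.
End MapsFromSources.

(** * Dividing out the bi-ideal of |1| - 1 *)

Section Kernel.
Variables (R : realType) (A B : vlaType R) (f : A -> B).
Hypothesis f_hom : vla_hom f.

Lemma kernel_bi_ideal : bi_ideal [set x | f x = 0].
Proof.
have [[fl fU fI] fM] := f_hom; split => /= [|x y fx fy|a x fx|x y xy fy|x y fy|x y fx].
- exact: lin_map0.
- by rewrite (lin_mapD fl) fx fy addr0.
- by rewrite (lin_mapZ fl) fx scaler0.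
- have := vl_hom_le f_hom.1 xy; rewrite !(vl_hom_abs f_hom.1) fy.
  have -> : vl_abs (0 : B) = 0.
    by apply/le_anti; rewrite vl_abs_ge0 vl_abs_le oppr0 lexx.
  rewrite vl_abs_le => /andP[x0 nx0]; apply/le_anti; rewrite x0 /=.
  by rewrite -vl_leN2 oppr0.
- by rewrite fM fy; have := vla_mulZr 0 (f x) 0; rewrite !scale0r.
- by rewrite fM fx; have := vla_mulZl 0 0 (f y); rewrite !scale0r.
Qed.
End Kernel.

Section AbsOneQuotient.
Variables (R : realType) (A : uvlaType R).

Definition abs_one_quot : Type := vla_quot (abs_one_ideal A).
HB.instance Definition _ := UVLA.on abs_one_quot.

Definition abs_one_pi : A -> abs_one_quot := vla_pi (abs_one_ideal A).

Lemma abs_one_pi_hom : uvla_hom abs_one_pi.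
Proof. exact: uvla_pi_hom. Qed.

Lemma abs_one_pi_surj X : exists x, abs_one_pi x = X.
Proof. by have [x ->] := vla_piP X; exists x. Qed.

Let one_ge0 : 0 <= (1%g : abs_one_quot).
Proof.
have [[pi_hom _] pi1] := abs_one_pi_hom.
have <- : abs_one_pi (vl_abs 1%g) = 1%g.
  by rewrite -pi1; apply/vla_pi_eq; apply: sub_gen_smallest.
by rewrite (vl_hom_abs pi_hom) vl_abs_ge0.
Qed.

HB.instance Definition _ := UVLA_hasPositiveOne.Build R abs_one_quot one_ge0.

(** The kernel of [f] is a bi-ideal, and it contains [|1| - 1] because [f]
preserves absolute values and [1] is its own absolute value in [B]. *)
Lemma abs_one_lift (B : upvlaType R) (f : A -> B) : uvla_hom f ->
  exists2 h : abs_one_quot -> B, uvla_hom h & f = h \o abs_one_pi.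
Proof.
move=> f_hom; have [[[fl fU fI] fM] f1] := f_hom.
have f_vl := f_hom.1.1.
have ker x : biIdeal_set (abs_one_ideal A) x -> f x = 0.
  apply: (smallest_sub (kernel_bi_ideal f_hom.1)) => _ -> /=.
  rewrite (lin_mapB fl) (vl_hom_abs f_vl) f1; apply/eqP; rewrite subr_eq0; apply/eqP.
  apply/le_anti; rewrite vl_le_abs vl_abs_le lexx /= andbT.
  by apply: le_trans (uvla_one_ge0 : 0 <= (1%g : B)); rewrite -oppr0 vl_leN2 uvla_one_ge0.
pose h (X : abs_one_quot) : B := f (repr (X : vla_quot _)).
have hE x : h (abs_one_pi x) = f x.
  by apply/eqP; rewrite -subr_eq0 -(lin_mapB fl); apply/eqP/ker/vla_pi_repr.
have [[[pil piU piI] piM] pi1] := abs_one_pi_hom.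
exists h; last by apply/funext => x /=; rewrite hE.
split; last by rewrite -pi1 hE.
split; first split.
- move=> a X Y; have [x <-] := abs_one_pi_surj X; have [y <-] := abs_one_pi_surj Y.
  by rewrite -pil !hE fl.
- move=> X Y; have [x <-] := abs_one_pi_surj X; have [y <-] := abs_one_pi_surj Y.
  by rewrite -piU !hE fU.
- move=> X Y; have [x <-] := abs_one_pi_surj X; have [y <-] := abs_one_pi_surj Y.
  by rewrite -piI !hE fI.
move=> X Y; have [x <-] := abs_one_pi_surj X; have [y <-] := abs_one_pi_surj Y.
by rewrite -piM !hE fM.
Qed.
End AbsOneQuotient.

Lemma free_uvla_upvla_quotient (R : realType) (O : Type)
    (hom1 : forall Y : uvlaType R, (O -> Y) -> Prop)
    (F5 : uvlaType R) (F6 : upvlaType R) (j5 : O -> F5) (j6 : O -> F6) :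
  (forall (X Y : uvlaType R) (phi : O -> X) (f : X -> Y),
     hom1 X phi -> uvla_hom f -> hom1 Y (f \o phi)) ->
  free_object hom1 (@uvla_hom R) j5 ->
  free_object (fun Y : upvlaType R => hom1 Y) (@upvla_hom R) j6 ->
  canonical_quotient j5 j6.
Proof.
move=> comp1 free5 free6.
have [psi psiP] := free5.2 F6 j6 free6.1; have [[psi_hom psij] _] := psiP.
pose Q : upvlaType R := abs_one_quot F5; pose pi : F5 -> Q := @abs_one_pi R F5.
have pi_hom : uvla_hom pi by exact: abs_one_pi_hom.
have pij1 : hom1 Q (pi \o j5) by apply: comp1 pi_hom; exact: free5.1.
have [g g_hom gj] := free_lift free6 (Y := Q) pij1.
have [h h_hom psiE] := abs_one_lift psi_hom.
(* The composite [g \o h] is the identity because [pi] and [g \o h \o pi] agree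
   on the generators of [F5]. *)
have ghpij : (g \o h \o pi) \o j5 = pi \o j5.
  by rewrite -gj psij psiE.
have ghpi : g \o h \o pi = pi.
  apply: (free_ext free5) => //; first by rewrite ghpij.
  by apply: uvla_hom_comp => //; exact: uvla_hom_comp h_hom g_hom.
(* Likewise [h \o g] fixes the generators of [F6]. *)
have hgj : (h \o g) \o j6 = j6.
  by rewrite psij psiE -[RHS]/(h \o (pi \o j5)) -gj psij psiE.
have hg : h \o g = id.
  apply: (free_ext free6) => //; first by rewrite hgj; exact: free6.1.
  exact: uvla_hom_comp g_hom h_hom.
have gK : cancel g h by move=> y; rewrite -[LHS]/((h \o g) y) hg.
have hK : cancel h g.
  by move=> X; have [x <-] := abs_one_pi_surj X; rewrite -[LHS]/((g \o h \o pi) x) ghpi.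
exists psi; split=> //.
  move=> y; have [x xE] := abs_one_pi_surj (g y); exists x.
  by rewrite psiE /= xE gK.
by exists h; split=> //; exists g.
Qed.

(** [A1] with its identity map is a free object over [A1] in its own
category. *)
Lemma uvla_upvla_quotient (R : realType) (A1 : uvlaType R) (F6 : upvlaType R)
    (j6 : A1 -> F6) :
  free_UVLA_UPVLA j6 ->
  surjective j6 /\ is_quotient_map (abs_one_ideal A1) j6.
Proof.
move=> free6.
have free_id : free_object (fun Y : uvlaType R => @uvla_hom R A1 Y)
    (@uvla_hom R) (id : A1 -> A1).
  split=> [|Y phi phi_hom]; first by [].
  by exists phi; split=> // f [].
have [psi [[[_ psiE] _] psi_surj psi_quot]] :
    canonical_quotient (id : A1 -> A1) j6.
  apply: (free_uvla_upvla_quotient _ free_id free6) => X Y phi f.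
  exact: uvla_hom_comp.
by rewrite psiE.
Qed.

(** * The theorem *)

Theorem theorem6p2 (R : realType) (S : Type) (S_nonempty : inhabited S)
    (V : lmodType R) (E : vlType R) (A : vlaType R) (A1 : uvlaType R) :
  [/\ (exists (F : lmodType R) (j : S -> F), free_Set_VS j),
      (exists (F : vlType R) (j : S -> F), free_Set_VL j),
      (exists (F : vlaType R) (j : S -> F), free_Set_VLA j),
      (exists (F : uvlaType R) (j : S -> F), free_Set_UVLA j)
    & (exists (F : upvlaType R) (j : S -> F), free_Set_UPVLA j)]
  /\
  [/\ (exists (F : vlType R) (j : V -> F), free_VS_VL j),
      (exists (F : vlaType R) (j : V -> F), free_VS_VLA j),
      (exists (F : uvlaType R) (j : V -> F), free_VS_UVLA j)
    & (exists (F : upvlaType R) (j : V -> F), free_VS_UPVLA j)]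
  /\
  [/\ (exists (F : vlaType R) (j : E -> F), free_VL_VLA j),
      (exists (F : uvlaType R) (j : E -> F), free_VL_UVLA j)
    & (exists (F : upvlaType R) (j : E -> F), free_VL_UPVLA j)]
  /\
  ((exists (F : uvlaType R) (j : A -> F), free_VLA_UVLA j) /\
   (exists (F : upvlaType R) (j : A -> F), free_VLA_UPVLA j))
  /\
  (exists (F : upvlaType R) (j : A1 -> F), free_UVLA_UPVLA j)
  /\
  (forall (F2 : lmodType R) (F3 : vlType R) (F4 : vlaType R)
      (F5 : uvlaType R) (F6 : upvlaType R)
      (j2 : S -> F2) (j3 : S -> F3) (j4 : S -> F4) (j5 : S -> F5)
      (j6 : S -> F6),
    free_Set_VS j2 -> free_Set_VL j3 -> free_Set_VLA j4 ->
    free_Set_UVLA j5 -> free_Set_UPVLA j6 ->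
    [/\ injective j2,
        canonical_injective (@vs_hom R F2 F3) j2 j3,
        canonical_injective (@vl_hom R F3 F4) j3 j4,
        canonical_injective (@vla_hom R F4 F5) j4 j5
      & canonical_injective (@vla_hom R F4 F6) j4 j6] /\
    canonical_quotient j5 j6)
  /\
  (forall (F3 : vlType R) (F4 : vlaType R)
      (F5 : uvlaType R) (F6 : upvlaType R)
      (j3 : V -> F3) (j4 : V -> F4) (j5 : V -> F5) (j6 : V -> F6),
    free_VS_VL j3 -> free_VS_VLA j4 -> free_VS_UVLA j5 -> free_VS_UPVLA j6 ->
    [/\ injective j3,
        canonical_injective (@vl_hom R F3 F4) j3 j4,
        canonical_injective (@vla_hom R F4 F5) j4 j5
      & canonical_injective (@vla_hom R F4 F6) j4 j6] /\
    canonical_quotient j5 j6)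
  /\
  (forall (F4 : vlaType R) (F5 : uvlaType R) (F6 : upvlaType R)
      (j4 : E -> F4) (j5 : E -> F5) (j6 : E -> F6),
    free_VL_VLA j4 -> free_VL_UVLA j5 -> free_VL_UPVLA j6 ->
    [/\ injective j4,
        canonical_injective (@vla_hom R F4 F5) j4 j5
      & canonical_injective (@vla_hom R F4 F6) j4 j6] /\
    canonical_quotient j5 j6)
  /\
  (forall (F5 : uvlaType R) (F6 : upvlaType R) (j5 : A -> F5) (j6 : A -> F6),
    free_VLA_UVLA j5 -> free_VLA_UPVLA j6 ->
    [/\ injective j5, injective j6 & canonical_quotient j5 j6])
  /\
  (forall (F6 : upvlaType R) (j6 : A1 -> F6),
    free_UVLA_UPVLA j6 ->
    surjective j6 /\ is_quotient_map (abs_one_ideal A1) j6).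
Proof.
have [VL VLA] := (@vl_homW R, @vla_homW R); have UVLA := @uvla_homW R.
split; first exact: exists_free_Set.
split; first exact: exists_free_VS.
split; first exact: exists_free_VL.
split; first exact: exists_free_VLA.
split; first exact: exists_free_UVLA.
split.
  move=> F2 F3 F4 F5 F6 j2 j3 j4 j5 j6 free2 free3 free4 free5 free6; split.
    split; first exact: free_Set_VS_injective free2.
    - exact: free_Set_VS_VL_injective.
    - exact: (vl_vla_canonical_injective _ free3 free4).
    - exact: (vla_uvla_canonical_injective _ free4 free5).
    - exact: (vla_upvla_canonical_injective _ free4 free6).
  exact: (free_uvla_upvla_quotient _ free5 free6).
split.
  move=> F3 F4 F5 F6 j3 j4 j5 j6 free3 free4 free5 free6; split.
    split; first exact: free_VS_VL_injective free3.
    - apply: (vl_vla_canonical_injective _ free3 free4) => X Y phi f phi1 /VL.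
      exact: vs_hom_comp.
    - apply: (vla_uvla_canonical_injective _ free4 free5) => X Y phi f phi1 /VLA/VL.
      exact: vs_hom_comp.
    - apply: (vla_upvla_canonical_injective _ free4 free6) => X Y phi f phi1 /VLA/VL.
      exact: vs_hom_comp.
  apply: (free_uvla_upvla_quotient _ free5 free6) => X Y phi f phi1 /UVLA/VLA/VL.
  exact: vs_hom_comp.
split.
  move=> F4 F5 F6 j4 j5 j6 free4 free5 free6; split.
    split; first exact: free_VL_VLA_injective free4.
    - apply: (vla_uvla_canonical_injective _ free4 free5) => X Y phi f phi1 /VLA.
      exact: vl_hom_comp.
    - apply: (vla_upvla_canonical_injective _ free4 free6) => X Y phi f phi1 /VLA.
      exact: vl_hom_comp.
  apply: (free_uvla_upvla_quotient _ free5 free6) => X Y phi f phi1 /UVLA/VLA.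
  exact: vl_hom_comp.
split; last exact: uvla_upvla_quotient.
move=> F5 F6 j5 j6 free5 free6; split.
- exact: free_VLA_UVLA_injective free5.
- exact: free_VLA_UPVLA_injective free6.
apply: (free_uvla_upvla_quotient _ free5 free6) => X Y phi f phi1 /UVLA.
exact: vla_hom_comp.
Qed.
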